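(* Let $E$ be a complex Banach space of scalar sequences such that $c_{00}\subset E$ is dense and such that coordinatewise domination implies norm domination: whenever $x=(x_j)\in E$ and the scalar sequence $y=(y_j)$ satisfies $|y_j|\le|x_j|$ for all $j\in\mathbb N$, then $y\in E$ and $\|y\|_E\le\|x\|_E$. Then the canonical unit vectors form a $1$-unconditional Schauder basis of $E$. Consequently, the associated monomials, with the square order in each homogeneous degree and any compatible global ordering, form a Schauder basis of $(\mathcal H(E),\tau_0)$.
   Context: $c_{00}$ is the space of finitely supported scalar sequences. A Schauder basis $(e_j)$ of a Banach space $X$ is $1$-unconditional if $\|\sum_j\lambda_jx_je_j\|\le\|\sum_jx_je_j\|$ whenever $\sum_j x_je_j\in X$ and $|\lambda_j|\le1$ for all $j$. $\mathcal H(X)$ is the space of entire holomorphic functions $X\to\mathbb C$, and $\tau_0$ is the compact-open topology, generated by the seminorms $\|f\|_K=\sup_{x\in K}|f(x)|$, $K\subset X$ compact. A Schauder basis of a locally convex space is understood in the usual sense (unique convergent expansions with continuous coefficient functionals). For a Schauder basis $(e_j)$ with coefficient functionals $(e_j^* )$, the associated monomials are $e^{*\alpha}(x)=\prod_je_j^*(x)^{\alpha_j}$, where $\alpha=(\alpha_j)_{j\ge1}$ ranges over finitely supported multi-indices with entries in $\mathbb N_0$; $|\alpha|=\sum_j\alpha_j$ is the degree and $\operatorname{len}(\alpha)=\max\operatorname{supp}(\alpha)$, $\operatorname{len}(0)=0$. Square order: for multi-indices of the same degree, $\alpha\prec\beta$ if either $\operatorname{len}(\alpha)<\operatorname{len}(\beta)$,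 or $\operatorname{len}(\alpha)=\operatorname{len}(\beta)$ and $\alpha_j<\beta_j$ for $j=\max\{i:\alpha_i\ne\beta_i\}$. An ordering (enumeration as a sequence) of all monomials is compatible if, for every $n\in\mathbb N_0$, its restriction to the degree-$n$ monomials agrees with the square order. *)

(* Defs.v *)
From HB Require Import structures.
From mathcomp Require Import all_boot all_order all_algebra finmap.
From mathcomp Require Import complex.
From mathcomp Require Import all_classical all_reals all_analysis.

Set Implicit Arguments.
Unset Strict Implicit.
Unset Printing Implicit Defensive.

Import Order.TTheory GRing.Theory Num.Theory.
Import numFieldNormedType.Exports.

Local Open Scope classical_set_scope.
Local Open Scope ring_scope.

Section SchauderBasis.
Context {K : numFieldType} {V : tvsType K}.

(* The equivalence says both that [v] is the sum of the series with
   coefficients [c ^~ v] and that no other coefficients represent [v]. *)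
Definition coefficient_functionals (b : nat -> V) (c : nat -> V -> K^o) :=
  (forall k, continuous (c k)) /\
  forall (v : V) (a : nat -> K),
    series (fun k => a k *: b k) @ \oo --> v <-> forall k, a k = c k v.

Definition schauder_basis (b : nat -> V) :=
  exists c, coefficient_functionals b c.

End SchauderBasis.

Definition unconditional1_basis {K : numFieldType} {X : normedModType K}
    (b : nat -> X) :=
  schauder_basis b /\
  forall (x : X) (a lambda : nat -> K),
    series (fun k => a k *: b k) @ \oo --> x ->
    (forall k, `|lambda k| <= 1) ->
    exists2 y, series (fun k => (lambda k * a k) *: b k) @ \oo --> y &
               `|y| <= `|x|.

Section EntireFunctions.
Context {R : realType} (E : normedModType R[i]).
Local Notation C := R[i]^o.

(* [differentiable] is Frechet differentiability over the scalar field of the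
   normed module, hence complex differentiability here. *)
Definition holomorphic : {pred E -> C} :=
  [pred f | `[< forall x, differentiable f x >]].

Record entire := Entire { entire_fun :> E -> C; _ : entire_fun \in holomorphic }.

HB.instance Definition _ := [isSub for entire_fun].
HB.instance Definition _ := [Choice of entire by <:].

Lemma holomorphic_submod_closed : subsemimod_closed holomorphic.
Proof.
split; first split.
- by apply/asboolP => x; exact: differentiable_cst.
- move=> f g /asboolP df /asboolP dg; apply/asboolP => x.
  exact: differentiableD.
- move=> a f /asboolP df; apply/asboolP => x; exact: differentiableZ.
Qed.

HB.instance Definition _ :=
  GRing.isSubmodClosed.Build R[i] (E -> C) holomorphic holomorphic_submod_closed.
HB.instance Definition _ := [SubChoice_isSubLmodule of entire by <:].

Lemma holomorphic_entire (f : entire) x : differentiable f x.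
Proof. by case: f => f /= /asboolP. Qed.

(* The compact-open topology, in its form as the topology of uniform
   convergence on compact sets. *)
HB.instance Definition _ := Uniform.copy entire
  (initial_topology (entire_fun : entire -> {family compact, E -> C})).

Lemma nbhs_entireP (f : entire) (U : set entire) :
  nbhs f U <-> exists (A : set E) (eps : R[i]), [/\ compact A, 0 < eps &
    forall g : entire, (forall x, A x -> `|f x - g x| < eps) -> U g].
Proof.
split=> [|[A [e [cA e0 AU]]]].
- case=> W [[Q oQ <-] Qf QU].
  pose F : set_system (E -> C) := [set P | exists (A : set E) (eps : R[i]),
    [/\ compact A, 0 < eps &
      forall g, (forall x, A x -> `|f x - g x| < eps) -> P g]].
  have FF : Filter F.
    split.
    + by exists set0, 1; split=> //; exact: compact0.
    + move=> P1 P2 [A [e [cA e0 AP1]]] [B [d [cB d0 BP2]]].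
      exists (A `|` B), (Order.min e d).
      have lt_mined (z : R[i]) :
          (z < Order.min e d) = (z < e) && (z < d).
        by rewrite comparable_lt_min// real_comparable ?gtr0_real.
      split; [exact: compactU|by rewrite lt_mined e0|].
      move=> g h; split; [apply: AP1|apply: BP2] => x xAB.
      * by have := h x (or_introl xAB); rewrite lt_mined => /andP[].
      * by have := h x (or_intror xAB); rewrite lt_mined => /andP[].
    + by move=> P1 P2 P12 [A [e [cA e0 AP]]]; exists A, e; split=> // g /AP; exact: P12.
  have Ff : F --> (entire_fun f : {family compact, E -> C}).
    apply/fam_cvgP => A cA P /uniform_nbhs[D [+ DP]].
    rewrite -entourage_ballE => -[e /= e0 eD].
    exists A, e; split=> // g h; apply: DP => x /h fgx.
    by apply: eD; rewrite /= -ball_normE.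
  have [] := Ff Q; first exact: open_nbhs_nbhs.
  by move=> A [e [cA e0 AQ]]; exists A, e; split=> // g /AQ; exact: QU.
- have : nbhs (entire_fun f : {family compact, E -> C})
      [set g : {family compact, E -> C} | forall x, A x -> `|f x - g x| < e].
    apply: (@fam_nbhs _ _ compact A [set xy | `|xy.1 - xy.2| < e]) => //.
    by rewrite -entourage_ballE; exists e => //= -[x y]; rewrite -ball_normE.
  rewrite nbhsE => -[Q [oQ Qf] QA].
  exists (entire_fun @^-1` Q); split => //.
    by exists Q.
  by move=> g /QA; exact: AU.
Qed.

Lemma entire_add_continuous : continuous (fun x : entire * entire => x.1 + x.2).
Proof.
move=> [f g] U /nbhs_entireP[A [e [cA e0 AU]]].
exists ([set h : entire | forall x, A x -> `|f x - h x| < e / 2],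
        [set h : entire | forall x, A x -> `|g x - h x| < e / 2]).
  by split; apply/nbhs_entireP; exists A, (e / 2); rewrite divr_gt0.
move=> [h k] [/= fh gk]; apply: AU => x Ax /=.
by rewrite opprD addrACA (splitr e) (le_lt_trans (ler_normD _ _))// ltrD ?fh ?gk.
Qed.

Lemma entire_bounded_on_compact (f : entire) (A : set E) :
  compact A -> exists2 M : R[i], 0 < M & forall x, A x -> `|f x| <= M.
Proof.
move=> /compact_near_coveringP cA.
suff : \forall M \near (pinfty_nbhs R[i]), A `<=` [set x | `|f x| <= M].
  move=> bA; near (pinfty_nbhs R[i]) => M; exists M.
    by near: M; apply: nbhs_pinfty_gt; exact: real0.
  by near: M.
apply: cA => x Ax.
have cf : {for x, continuous (entire_fun f)}.
  by apply: differentiable_continuous; exact: holomorphic_entire.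
exists ([set y | `|f x - f y| < 1], [set M : R[i] | `|f x| + 1 < M]).
  split; last by apply: nbhs_pinfty_gt; rewrite realD ?normr_real// real1.
  by move/cvgrPdist_lt : cf => /(_ 1 ltr01).
move=> [y M] [/= fxy fxM]; rewrite (le_trans _ (ltW fxM))//.
by rewrite -[f y](subKr (f x)) (le_trans (ler_normB _ _))// lerD2l ltW.
Unshelve. all: by end_near. Qed.

Lemma entire_scale_continuous :
  continuous (fun z : R[i]^o * entire => z.1 *: z.2).
Proof.
move=> [a f] U /nbhs_entireP[A [e [cA e0 AU]]].
have [M M0 fM] := entire_bounded_on_compact f cA.
have a1 : 0 < `|a| + 1 by rewrite ltr_wpDl.
have e2M : 0 < e / 2 / M by rewrite !divr_gt0.
pose B : set R[i]^o := [set b | `|a - b| < e / 2 / M] `&` [set b | `|a - b| < 1].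
exists (B, [set h : entire | forall x, A x -> `|f x - h x| < e / 2 / (`|a| + 1)]).
  split; last by apply/nbhs_entireP; exists A, (e / 2 / (`|a| + 1)); rewrite !divr_gt0.
  by apply: filterI; [exact: (@nbhsx_ballx _ R[i]^o)|exact: (@nbhsx_ballx _ R[i]^o)].
move=> [b h] [/= [abM ab1] fh]; apply: AU => x Ax /=.
have ba : `|b| < `|a| + 1.
  by rewrite -[b](subKr a) (le_lt_trans (ler_normB _ _))// ltrD2l.
have -> : (a *: f) x - (b *: h) x = (a - b) * f x + b * (f x - h x).
  by rewrite mulrBl mulrBr addrA subrK.
rewrite (splitr e) (le_lt_trans (ler_normD _ _))// !normrM ler_ltD//.
  rewrite (le_trans (ler_wpM2l _ (fM x Ax)))//.
  by rewrite -ler_pdivlMr// ltW.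
rewrite (le_lt_trans (ler_wpM2r _ (ltW ba)))//.
by rewrite mulrC -ltr_pdivlMr// fh.
Qed.

Lemma entire_locally_convex : exists2 B : set_system entire,
  (forall b, b \in B -> convex_set b) & basis B.
Proof.
pose N (f : entire) (A : set E) (e : R[i]) : set entire := [set g |
  exists2 r, 0 < r < e & forall x, A x -> `|f x - g x| <= r].
exists [set b | exists f A e, [/\ compact A, 0 < e & b = N f A e]].
  move=> b /set_mem[f [A [e [cA e0 ->]]]] g h t.
  move=> /set_mem[r /andP[r0 re] fg] /set_mem[s /andP[s0 se] fh].
  apply/mem_set; have rs : r >=< s by rewrite real_comparable ?gtr0_real.
  exists (Order.max r s); first by rewrite comparable_gt_max// comparable_lt_max// r0 re se.
  move=> x Ax.
  have t01 : 0 <= t%:num :> R[i] /\ t%:num <= 1 :> R[i] by split.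
  case: t01; set k := t%:num => k0 k1.
  have -> : f x - (k *: g + (1 - k) *: h : entire) x =
      k * (f x - g x) + (1 - k) * (f x - h x).
    by rewrite !mulrBr addrACA -mulrDl subrKC mul1r opprD.
  have k1' : 0 <= 1 - k by rewrite subr_ge0.
  have -> : Order.max r s = k * Order.max r s + (1 - k) * Order.max r s.
    by rewrite -mulrDl subrKC mul1r.
  rewrite (le_trans (ler_normD _ _))// !normrM (ger0_norm k0) (ger0_norm k1').
  by rewrite lerD// ler_wpM2l// comparable_le_max ?(fg _ Ax, fh _ Ax) ?orbT.
split.
- move=> _ [f [A [e [cA e0 ->]]]]; rewrite openE => g [r /andP[r0 re] fg].
  have re2 : 0 < (e - r) / 2 by rewrite divr_gt0 ?subr_gt0.
  apply/nbhs_entireP; exists A, ((e - r) / 2); split => //.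
  move=> h gh; exists (r + (e - r) / 2).
    rewrite addr_gt0//= -ltrBrDl gtr_pMr ?subr_gt0//.
    by rewrite invf_lt1// ltr1n.
  move=> x Ax; rewrite -(subrKA (g x)) (le_trans (ler_normD _ _))// lerD ?fg//.
  exact/ltW/gh.
- move=> f U /nbhs_entireP[A [e [cA e0 AU]]].
  exists (N f A e).
    split; first by exists f, A, e.
    exists (e / 2); first by rewrite divr_gt0//= gtr_pMr// invf_lt1// ltr1n.
    by move=> x Ax; rewrite subrr normr0 ltW// divr_gt0.
  move=> g [r /andP[r0 re] fg]; apply: AU => x Ax; exact: le_lt_trans (fg x Ax) re.
Qed.

HB.instance Definition _ := PreTopologicalNmodule_isTopologicalNmodule.Build
  entire entire_add_continuous.
HB.instance Definition _ := TopologicalNmodule_isTopologicalLmodule.Build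
  R[i] entire entire_scale_continuous.
HB.instance Definition _ :=
  Uniform_isTvs.Build R[i] entire entire_locally_convex.

End EntireFunctions.

(* Multi-indices are indexed from 0, so that [j] below stands for the index
   usually written j + 1; this is why [mlen] takes the maximum of [j.+1]. *)
Definition multiindex := {fsfun nat -> nat with 0%N}.

Definition mdegree (alpha : multiindex) : nat :=
  (\sum_(j <- finsupp alpha) alpha j)%N.

Definition mlen (alpha : multiindex) : nat :=
  (\max_(j <- finsupp alpha) j.+1)%N.

(* [j] is the largest index at which [alpha] and [beta] differ. *)
Definition square_lt (alpha beta : multiindex) : Prop :=
  (mlen alpha < mlen beta)%N \/
  mlen alpha = mlen beta /\
  exists2 j, (alpha j < beta j)%N & forall i, (j < i)%N -> alpha i = beta i.

Definition compatible (alpha : nat -> multiindex) : Prop :=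
  bijective alpha /\
  forall k l, mdegree (alpha k) = mdegree (alpha l) ->
    (k < l)%N <-> square_lt (alpha k) (alpha l).

Definition monomial {K : numFieldType} {X : Type} (c : nat -> X -> K)
    (alpha : multiindex) (x : X) : K :=
  \prod_(j <- finsupp alpha) c j x ^+ alpha j.

Definition finitely_supported {K : numFieldType} (x : nat -> K) :=
  finite_set [set j | x j != 0].

(* Main.v *)
Require Import Defs.
From HB Require Import structures.
From mathcomp Require Import all_boot all_order all_algebra finmap.
From mathcomp Require Import complex.
From mathcomp Require Import all_classical all_reals all_analysis.
From mathcomp Require Import ring lra zify.
Set Implicit Arguments.
Unset Strict Implicit.
Unset Printing Implicit Defensive.
Import Order.TTheory GRing.Theory Num.Theory.
Import numFieldNormedType.Exports.
Local Open Scope classical_set_scope.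
Local Open Scope ring_scope.


(** Coordinatewise domination makes every diagonal operator with entries of
    modulus at most 1 a contraction. Hence the truncations of a sequence are
    contractions; they converge on the dense subspace of finitely supported
    sequences, therefore everywhere, and the unit vectors form a 1-unconditional
    basis.

    For the monomials, two facts suffice: the polynomials are dense in the entire
    functions for the compact-open topology, and the partial sums of the monomial
    expansion of a polynomial are bounded on a compact set [A] by the polynomial
    on a larger compact set that depends only on [A]. The second fact, applied to
    consecutive partial sums, bounds the coefficients, so that they extend
    continuously from polynomials to entire functions; equicontinuity of the
    partial sums and density then give convergence, and continuity of the
    coefficients gives uniqueness.

    The bound on partial sums (partial_sum_bound) is where the square order is
    used. Among multi-indices of one degree it is the colexicographic order, in
    which the predecessors of [beta] split into classes given by prescribing the
    exponents from some position on; in degree [d] there are [d] classes. The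
    part of a polynomial in such a class is a weighted average of its values at
    points whose coordinates are multiplied by roots of unity, so it is bounded
    by the supremum over these points. The partial sums in degree [d] thus lose
    a factor of at most [d.+1]; these losses become summable over the degrees
    when the coordinates are also multiplied by 4, which gains [4 ^- d]. The
    points needed form a compact set (hull_compact): it is a continuous image of
    the product of [A] and a cube of angles, which is compact by Tychonoff's
    theorem.

    Density (spanned_dense) is reduced to functions of finitely many coordinates
    by truncation. There each coordinate in turn is replaced by a discrete Cauchy
    mean over a circle, which is polynomial in this coordinate. That these means
    converge (cauchy_mean_cvg) is the Cauchy integral formula with the integral
    replaced by the trapezoidal rule at the [2 ^ m]-th roots of unity; it follows
    from Goursat's bisection argument, carried out for trapezoidal sums
    (goursat). Uniformity on compact sets comes from equicontinuity of the means. *)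

(** * Moduli of complex numbers *)

Notation "'normc' z" := (Normc.normc z) (at level 10, z at level 8).

Section ModulusOfComplexNumbers.
Variable R : realType.
Implicit Types x y z : R[i].

Lemma normE z : `|z| = (normc z)%:C%C.
Proof. by []. Qed.

Lemma normc_ge0 z : 0 <= normc z.
Proof. by rewrite -ler0c -normE. Qed.

Lemma normcD_le x y : normc (x + y) <= normc x + normc y.
Proof. exact: (le_normcD x y). Qed.

Lemma normc_opp z : normc (- z) = normc z.
Proof. exact: (normcN z). Qed.

Lemma normcB_le x y : normc (x - y) <= normc x + normc y.
Proof. by rewrite -[leRHS](congr1 (fun u => _ + u) (normc_opp y)) normcD_le. Qed.

Lemma normc_mul x y : normc (x * y) = normc x * normc y.
Proof. exact: Normc.normcM. Qed.

Lemma normc_real (r : R) : normc (r%:C%C) = `|r|.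
Proof. by rewrite /= expr0n /= addr0 sqrtr_sqr. Qed.

Lemma normc_nat n : normc (n%:R : R[i]) = n%:R.
Proof.
have -> : (n%:R : R[i]) = (n%:R)%:C%C by rewrite rmorph_nat.
by rewrite normc_real ger0_norm.
Qed.

Lemma normc_inv z : normc z^-1 = (normc z)^-1.
Proof. exact: Normc.normcV. Qed.

Lemma normc_exp z n : normc (z ^+ n) = normc z ^+ n.
Proof.
elim: n => [|n IH]; first by rewrite !expr0 Normc.normc1.
by rewrite !exprS normc_mul IH.
Qed.

Lemma normc_sum I (r : seq I) (P : pred I) (F : I -> R[i]) :
  normc (\sum_(i <- r | P i) F i) <= \sum_(i <- r | P i) normc (F i).
Proof.
elim/big_rec2: _ => [|i y1 y2 _ h]; first by rewrite Normc.normc0.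
by rewrite (le_trans (normcD_le _ _))// lerD2l.
Qed.

Lemma normc_le_ReIm z : normc z <= `|complex.Re z| + `|complex.Im z|.
Proof.
case: z => a b /=; rewrite -[leRHS]ger0_norm ?addr_ge0//.
rewrite -sqrtr_sqr ler_sqrt ?sqr_ge0// sqrrD !real_normK ?num_real//.
rewrite lerD2r lerDl; apply: mulrn_wge0; exact: mulr_ge0.
Qed.

Lemma normc_eq0 z : (normc z == 0) = (z == 0).
Proof. by apply/eqP/eqP => [/Normc.eq0_normc|->]; last exact: Normc.normc0. Qed.

Lemma normc_gt0 z : (0 < normc z) = (z != 0).
Proof. by rewrite lt_def normc_ge0 andbT normc_eq0. Qed.

Lemma ReB (z w : R[i]) : complex.Re (z - w) = complex.Re z - complex.Re w.
Proof. by case: z w => [? ?] [? ?]. Qed.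

Lemma ImB (z w : R[i]) : complex.Im (z - w) = complex.Im z - complex.Im w.
Proof. by case: z w => [? ?] [? ?]. Qed.

Lemma Re_le_normc (z : R[i]) : `|complex.Re z| <= normc z.
Proof. by rewrite -lecR -normE; exact: normc_ge_Re. Qed.

Lemma Im_le_normc (z : R[i]) : `|complex.Im z| <= normc z.
Proof.
by case: z => a b /=; rewrite -sqrtr_sqr ler_wsqrtr// lerDr sqr_ge0.
Qed.

End ModulusOfComplexNumbers.

(** * Trapezoidal sums and Goursat's lemma *)

Section TrapezoidalSums.
Variable R : realType.
Implicit Types (h : R[i] -> R[i]) (g : R -> R[i]).

(** The trapezoidal approximation of the integral of [h] over the segment from
    [a] to [b]. *)
Definition edge h (a b : R[i]) : R[i] := (h a + h b) / 2 * (b - a).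

(** Trapezoidal sum of [h] along the curve [g] over the interval from [a] to
    [a + d]. The [2 ^ m] equal steps are produced by repeated bisection, since
    this is how Goursat's argument takes them apart. *)
Fixpoint trap h g (m : nat) (a d : R) : R[i] :=
  if m is k.+1 then trap h g k a (d / 2) + trap h g k (a + d / 2) (d / 2)
  else edge h (g a) (g (a + d)).

Lemma addr_half (a d : R) : a + d / 2 + d / 2 = a + d.
Proof. by field. Qed.

Lemma trapD h1 h2 g m a d :
  trap (fun w => h1 w + h2 w) g m a d = trap h1 g m a d + trap h2 g m a d.
Proof.
elim: m a d => [|m IH] a d /=; first by rewrite /edge; field.
by rewrite !IH addrACA.
Qed.

Lemma eq_trap h1 h2 g1 g2 m a d : h1 =1 h2 -> g1 =1 g2 ->
  trap h1 g1 m a d = trap h2 g2 m a d.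
Proof.
by move=> e1 e2; elim: m a d => [|m IH] a d /=; rewrite ?IH// /edge !e1 !e2.
Qed.

(** The trapezoidal rule is exact for affine integrands, which makes its value
    a difference of values of a primitive at the endpoints. *)
Lemma trap_affine (A B : R[i]) g m a d :
  trap (fun w => A + B * w) g m a d =
  (A * g (a + d) + B / 2 * g (a + d) ^+ 2) - (A * g a + B / 2 * g a ^+ 2).
Proof.
elim: m a d => [|m IH] a d /=; first by rewrite /edge; field.
by rewrite !IH addr_half; ring.
Qed.

Lemma trap_bound h g m a d (M L : R) : 0 <= d -> 0 <= M ->
  (forall u v, a <= u <= a + d -> a <= v <= a + d ->
     normc (g u - g v) <= L * `|u - v|) ->
  (forall u, a <= u <= a + d -> normc (h (g u)) <= M) ->
  normc (trap h g m a d) <= M * L * d.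
Proof.
move=> d0 M0; elim: m a d d0 => [|m IH] a d d0 gL hM /=.
  rewrite /edge normc_mul -mulrA; apply: ler_pM; rewrite ?normc_ge0//.
    rewrite normc_mul normc_inv normc_nat ler_pdivrMr//.
    have := normcD_le (h (g a)) (h (g (a + d))).
    have := hM a _; have := hM (a + d) _; rewrite !lexx lerDl d0 => /(_ isT) + /(_ isT).
    lra.
  have := gL (a + d) a; rewrite !lexx lerDl d0 => /(_ isT isT).
  by rewrite addrAC subrr add0r (ger0_norm d0).
have d20 : 0 <= d / 2 by lra.
rewrite (le_trans (normcD_le _ _))//.
have -> : M * L * d = M * L * (d / 2) + M * L * (d / 2) by field.
by apply: lerD; apply: IH => // [u v ? ?|u ?]; rewrite ?gL ?hM//; lra.
Qed.

Lemma trap_sum h g m a d : trap h g m a d =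
  \sum_(l < 2 ^ m) edge h (g (a + l%:R * (d / (2 ^ m)%:R)))
                          (g (a + l.+1%:R * (d / (2 ^ m)%:R))).
Proof.
elim: m a d => [|m IH] a d /=.
  by rewrite expn0 big_ord1 mul0r addr0 mul1r divr1.
rewrite !IH; set N := (2 ^ m)%N.
have N0 : N%:R != 0 :> R by rewrite pnatr_eq0 -lt0n expn_gt0.
have dN : d / (N + N)%:R = d / 2 / N%:R by rewrite -mulrA -invfM -natrM mul2n addnn.
have eN : (2 ^ m.+1 = N + N)%N by rewrite expnS mul2n addnn.
rewrite [RHS](_ : _ = \sum_(l < N + N) edge h (g (a + l%:R * (d / (N + N)%:R)))
                          (g (a + l.+1%:R * (d / (N + N)%:R)))); last first.
  by rewrite -eN.
rewrite big_split_ord /=; congr (_ + _); apply: eq_bigr => l _.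
  by rewrite dN.
rewrite dN -addnS !natrD.
have shift x : a + (N%:R + x) * (d / 2 / N%:R) = a + d / 2 + x * (d / 2 / N%:R).
  by field.
by rewrite !shift.
Qed.

End TrapezoidalSums.

Section Goursat.
Variable R : realType.
Implicit Types (h : R[i] -> R[i]) (p : R -> R -> R[i]).

(** Trapezoidal sum along the image under [p] of the boundary of the square with
    lower left corner [(s, t)] and side [d]. *)
Definition circulation h p (m : nat) (s t d : R) : R[i] :=
  trap h (p^~ t) m s d + trap h (p (s + d)) m t d
  - trap h (p^~ (t + d)) m s d - trap h (p s) m t d.

(** The inner sides of the four quarters cancel. *)
Lemma circulationS h p m s t d : let d' := d / 2 in
  circulation h p m.+1 s t d =
  circulation h p m s t d' + circulation h p m (s + d') t d' +
  circulation h p m s (t + d') d' + circulation h p m (s + d') (t + d') d'.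
Proof. by rewrite /circulation /= !addr_half; ring. Qed.

Lemma circulation_affine (A B : R[i]) p m s t d :
  circulation (fun w => A + B * w) p m s t d = 0.
Proof. by rewrite /circulation !trap_affine; ring. Qed.

Lemma circulationD h1 h2 p m s t d :
  circulation (fun w => h1 w + h2 w) p m s t d =
  circulation h1 p m s t d + circulation h2 p m s t d.
Proof. by rewrite /circulation !trapD; ring. Qed.

Lemma circulation_bound h p m s t d (M L : R) : 0 <= d -> 0 <= M ->
  (forall u u' v v', s <= u <= s + d -> s <= u' <= s + d ->
     t <= v <= t + d -> t <= v' <= t + d ->
     normc (p u v - p u' v') <= L * (`|u - u'| + `|v - v'|)) ->
  (forall u v, s <= u <= s + d -> t <= v <= t + d -> normc (h (p u v)) <= M) ->
  normc (circulation h p m s t d) <= 4 * (M * L * d).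
Proof.
move=> d0 M0 pL hM.
have pl u v v' : s <= u <= s + d -> t <= v <= t + d -> t <= v' <= t + d ->
    normc (p u v - p u v') <= L * `|v - v'|.
  by move=> us vt vt'; have := pL u u v v' us us vt vt'; rewrite subrr normr0 add0r.
have pr u u' v : s <= u <= s + d -> s <= u' <= s + d -> t <= v <= t + d ->
    normc (p u v - p u' v) <= L * `|u - u'|.
  by move=> us us' vt; have := pL u u' v v us us' vt vt; rewrite subrr normr0 addr0.
have sd : s <= s + d <= s + d by rewrite lexx lerDl d0.
have td : t <= t + d <= t + d by rewrite lexx lerDl d0.
have ss : s <= s <= s + d by rewrite lexx lerDl d0.
have tt : t <= t <= t + d by rewrite lexx lerDl d0.
have b1 : normc (trap h (p^~ t) m s d) <= M * L * d.
  by apply: trap_bound => // [u v us vs|u us]; [rewrite ?pr ?pl|exact: hM].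
have b2 : normc (trap h (p (s + d)) m t d) <= M * L * d.
  by apply: trap_bound => // [u v us vs|u us]; [rewrite ?pr ?pl|exact: hM].
have b3 : normc (trap h (p^~ (t + d)) m s d) <= M * L * d.
  by apply: trap_bound => // [u v us vs|u us]; [rewrite ?pr ?pl|exact: hM].
have b4 : normc (trap h (p s) m t d) <= M * L * d.
  by apply: trap_bound => // [u v us vs|u us]; [rewrite ?pr ?pl|exact: hM].
rewrite /circulation; move: (trap _ _ _ _ _) (trap _ _ _ _ _) (trap _ _ _ _ _)
  (trap _ _ _ _ _) b1 b2 b3 b4 => x4 x3 x2 x1 b1 b2 b3 b4.
have := normcB_le (x1 + x2 - x3) x4; have := normcB_le (x1 + x2) x3.
have := normcD_le x1 x2; lra.
Qed.

(** Complex differentiability as a first-order expansion with real error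
    bounds. *)
Definition cdiff_at h z := exists D : R[i], forall eps : R, 0 < eps ->
  exists2 delta : R, 0 < delta & forall w, normc (w - z) < delta ->
    normc (h w - h z - D * (w - z)) <= eps * normc (w - z).

(** The lower bound is proportional to the area, so that it passes from a square
    to at least one of its quarters. It is required for arbitrarily large [m]
    because passing to a quarter lowers [m] by one. *)
Definition bad_square h p (eta : R) (q : R * R) (d : R) :=
  forall M, exists2 m, (M <= m)%N & eta * d ^+ 2 <= normc (circulation h p m q.1 q.2 d).

Lemma bad_square_half h p eta q d : 0 < d -> bad_square h p eta q d ->
  exists2 q', bad_square h p eta q' (d / 2) &
    [/\ q.1 <= q'.1, q'.1 + d / 2 <= q.1 + d, q.2 <= q'.2 & q'.2 + d / 2 <= q.2 + d].
Proof.
move=> d0 bad; case: q bad => s t bad.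
have good q' : ~ bad_square h p eta q' (d / 2) -> exists M, forall m, (M <= m)%N ->
    normc (circulation h p m q'.1 q'.2 (d / 2)) < eta * (d / 2) ^+ 2.
  move=> nb; apply: contrapT => ng; apply: nb => M; apply: contrapT => nm.
  apply: ng; exists M => m Mm; rewrite ltNge; apply/negP => le; apply: nm.
  by exists m.
have [b1|/good[M1 g1]] := pselect (bad_square h p eta (s, t) (d / 2)).
  by exists (s, t) => //=; split; lra.
have [b2|/good[M2 g2]] := pselect (bad_square h p eta (s + d / 2, t) (d / 2)).
  by exists (s + d / 2, t) => //=; split; lra.
have [b3|/good[M3 g3]] := pselect (bad_square h p eta (s, t + d / 2) (d / 2)).
  by exists (s, t + d / 2) => //=; split; lra.
have [b4|/good[M4 g4]] := pselect (bad_square h p eta (s + d / 2, t + d / 2) (d / 2)).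
  by exists (s + d / 2, t + d / 2) => //=; split; lra.
have [[//|m]] := bad (maxn (maxn M1 M2) (maxn M3 M4)).+1.
rewrite ltnS !geq_max => /andP[/andP[m1 m2] /andP[m3 m4]] /=.
rewrite circulationS /=; move: (g1 m m1) (g2 m m2) (g3 m m3) (g4 m m4) => /=.
move: (circulation _ _ _ s t _) => c1; move: (circulation _ _ _ (s + _) t _) => c2.
move: (circulation _ _ _ s _ _) => c3; move: (circulation _ _ _ _ _ _) => c4.
have := normcD_le (c1 + c2 + c3) c4; have := normcD_le (c1 + c2) c3.
have := normcD_le c1 c2.
have -> : eta * d ^+ 2 = 4 * (eta * (d / 2) ^+ 2) by field.
lra.
Qed.

Lemma bad_square_seq h p eta q : bad_square h p eta q 1 ->
  exists q_ : nat -> R * R, q_ 0%N = q /\ forall n,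
    bad_square h p eta (q_ n) (2 ^- n) /\
    [/\ (q_ n).1 <= (q_ n.+1).1, (q_ n.+1).1 + 2 ^- n.+1 <= (q_ n).1 + 2 ^- n,
        (q_ n).2 <= (q_ n.+1).2 & (q_ n.+1).2 + 2 ^- n.+1 <= (q_ n).2 + 2 ^- n].
Proof.
move=> bad0.
have half n : 2 ^- n.+1 = 2 ^- n / 2 :> R by rewrite exprSr invfM.
pose S n (q q' : R * R) := bad_square h p eta q (2 ^- n) ->
  bad_square h p eta q' (2 ^- n.+1) /\
    [/\ q.1 <= q'.1, q'.1 + 2 ^- n.+1 <= q.1 + 2 ^- n,
        q.2 <= q'.2 & q'.2 + 2 ^- n.+1 <= q.2 + 2 ^- n].
have ex n q0 : exists q', S n q0 q'.
  have [b|nb] := pselect (bad_square h p eta q0 (2 ^- n)); last by exists q0.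
  have [|q' b' H] := bad_square_half _ b; first by rewrite invr_gt0 exprn_gt0.
  by exists q' => _; rewrite half.
pose f n q0 := projT1 (cid (ex n q0)).
have fS n q0 : S n q0 (f n q0) by rewrite /f; case: cid.
pose q_ := fix F n := if n is k.+1 then f k (F k) else q.
have qb n : bad_square h p eta (q_ n) (2 ^- n).
  elim: n => [|n IH]; first by rewrite /= expr0 invr1.
  exact: (fS n (q_ n) IH).1.
exists q_; split => // n; split => //; exact: (fS n (q_ n) (qb n)).2.
Qed.

Lemma separating_point I (P : I -> Prop) (a b : I -> R) : (exists i, P i) ->
  (forall i j, P i -> P j -> a i <= b j) -> exists r : R, forall i, P i -> a i <= r <= b i.
Proof.
move=> [i0 Pi0] ab; have hs : has_sup [set a i | i in P].
  by split; [exists (a i0), i0|exists (b i0) => _ [i Pi <-]; exact: ab].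
exists (sup [set a i | i in P]) => i Pi; apply/andP; split.
  by apply: ub_le_sup; [exact: hs.2|exists i].
by apply: ge_sup; [exact: hs.1|move=> _ [j Pj <-]; exact: ab].
Qed.

Lemma nested_intervals (a b : nat -> R) :
  (forall n, a n <= a n.+1) -> (forall n, b n.+1 <= b n) -> (forall n, a n <= b n) ->
  exists r, forall n, a n <= r <= b n.
Proof.
move=> ai bi ab.
have am : {homo a : i j / (i <= j)%N >-> i <= j}.
  by apply: homo_leq => // y x z; exact: le_trans.
have bm : {homo b : i j / (i <= j)%N >-> j <= i}.
  by apply: (@homo_leq _ b (fun x y => y <= x)) => // y x z xy yz; exact: le_trans yz xy.
have [|i j _ _|r rP] := @separating_point _ (fun=> True) a b; [by exists 0%N| |].
  have [ij|/ltnW ij] := leqP i j; first exact: le_trans (am _ _ ij) (ab j).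
  exact: le_trans (ab i) (bm _ _ ij).
by exists r => n; exact: rP.
Qed.

(** Goursat's argument. A square whose circulations stay above a fixed multiple
    of its area would have a quarter with that property; the nested quarters
    shrink to a point, where [h] is so close to an affine function, the
    circulation of which vanishes, that this is impossible. *)
Lemma goursat h p (L : R) : 0 < L ->
  (forall u u' v v', 0 <= u <= 1 -> 0 <= u' <= 1 -> 0 <= v <= 1 -> 0 <= v' <= 1 ->
     normc (p u v - p u' v') <= L * (`|u - u'| + `|v - v'|)) ->
  (forall u v, 0 <= u <= 1 -> 0 <= v <= 1 -> cdiff_at h (p u v)) ->
  forall eps, 0 < eps -> exists M, forall m, (M <= m)%N ->
    normc (circulation h p m 0 0 1) < eps.
Proof.
move=> L0 pL hd eta eta0; apply: contrapT => nM.
have : bad_square h p eta (0, 0) 1.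
  move=> M; apply: contrapT => nm; apply: nM; exists M => m Mm.
  rewrite ltNge; apply/negP => le; apply: nm; exists m => //.
  by rewrite expr1n mulr1.
move=> /bad_square_seq[q_ [q0 qS]].
have [s sP] : exists s, forall n, (q_ n).1 <= s <= (q_ n).1 + 2 ^- n.
  apply: nested_intervals => n; [by have [_ []] := qS n|by have [_ []] := qS n|].
  by rewrite lerDl invr_ge0 exprn_ge0.
have [t tP] : exists t, forall n, (q_ n).2 <= t <= (q_ n).2 + 2 ^- n.
  apply: nested_intervals => n; [by have [_ []] := qS n|by have [_ []] := qS n|].
  by rewrite lerDl invr_ge0 exprn_ge0.
have s01 : 0 <= s <= 1 by have := sP 0%N; rewrite q0 expr0 invr1 add0r.
have t01 : 0 <= t <= 1 by have := tP 0%N; rewrite q0 expr0 invr1 add0r.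
have q01 n : [/\ 0 <= (q_ n).1, (q_ n).1 + 2 ^- n <= 1, 0 <= (q_ n).2
    & (q_ n).2 + 2 ^- n <= 1].
  elim: n => [|n [a1 b1 a2 b2]]; first by rewrite q0 expr0 invr1 add0r.
  by have [_ [? ? ? ?]] := qS n; split; lra.
have [D hD] := hd s t s01 t01; set z := p s t in hD.
(* The affine part contributes nothing, and the remainder contributes at most
   [8 * ep * L ^+ 2 * d ^+ 2], which this choice makes half of [eta * d ^+ 2]. *)
pose ep := eta / (16 * L ^+ 2).
have ep0 : 0 < ep by rewrite divr_gt0// mulr_gt0// exprn_gt0.
have [de de0 {}hD] := hD ep ep0.
have [n nde] : exists n, 2 * L * 2 ^- n < de.
  have L20 : 0 < (2 * L)^-1 * de by rewrite mulr_gt0// invr_gt0; lra.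
  have h1 : `|2^-1 : R| < 1 by rewrite ger0_norm// invf_lt1// ltr1n.
  have /cvgrPdist_lt/(_ _ L20)[n _ /(_ n (leqnn n))] := cvg_expr h1.
  rewrite /= sub0r normrN exprVn ger0_norm ?invr_ge0 ?exprn_ge0// => H.
  by exists n; rewrite -ltr_pdivlMl//; lra.
set d := (2 ^- n : R) in nde; have d0 : 0 < d by rewrite invr_gt0 exprn_gt0.
have [m _] := (qS n).1 0%N; rewrite -/d; apply/negP; rewrite -ltNge.
pose r w := h w - h z - D * (w - z).
have hE : h = fun w => ((h z - D * z) + D * w) + r w.
  by apply/funext => w; rewrite /r; ring.
rewrite hE circulationD circulation_affine add0r.
have near_z u v : (q_ n).1 <= u <= (q_ n).1 + d -> (q_ n).2 <= v <= (q_ n).2 + d ->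
    normc (p u v - z) <= 2 * L * d.
  move=> uP vP; have [a1 b1 a2 b2] := q01 n.
  have [uP' vP'] : 0 <= u <= 1 /\ 0 <= v <= 1 by rewrite -/d in b1 b2; split; lra.
  rewrite (le_trans (pL _ _ _ _ uP' s01 vP' t01))//.
  have : `|u - s| <= d by rewrite ler_norml; have := sP n; rewrite -/d; lra.
  have : `|v - t| <= d by rewrite ler_norml; have := tP n; rewrite -/d; lra.
  move=> h1 h2; have -> : 2 * L * d = L * (d + d) by ring.
  by rewrite ler_pM2l// lerD.
apply: le_lt_trans.
  apply: (@circulation_bound _ _ _ _ _ _ (ep * (2 * L * d)) L).
  - exact: ltW.
  - by rewrite mulr_ge0 ?(ltW ep0)// mulr_ge0 ?(ltW d0)//; lra.
  - move=> u u' v v' us us' vt vt'; have [a1 b1 a2 b2] := q01 n.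
    by rewrite -/d in b1 b2; apply: pL; lra.
  - move=> u v uP vP; have nz := near_z u v uP vP.
    rewrite (le_trans (hD _ _))//; first exact: le_lt_trans nz nde.
    by rewrite ler_pM2l.
have -> : 4 * (ep * (2 * L * d) * L * d) = eta * d ^+ 2 / 2.
  by rewrite /ep; field; rewrite ?gt_eqF.
have : 0 < eta * d ^+ 2 by rewrite mulr_gt0// exprn_gt0.
lra.
Qed.

End Goursat.

(** * Dyadic roots of unity *)

Section CircleParametrization.
Variable R : realType.
Implicit Types s t : R.

(** The point of the unit circle reached after [t] full turns. *)
Definition turn t : R[i] := (cos (2 * pi * t) +i* sin (2 * pi * t))%C.

Lemma turnD s t : turn (s + t) = turn s * turn t.
Proof.
rewrite /turn mulrDr cosD sinD; congr Complex; ring.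
Qed.

Lemma turn0 : turn 0 = 1.
Proof. by rewrite /turn mulr0 cos0 sin0. Qed.

Lemma turn1 : turn 1 = 1.
Proof. by rewrite /turn mulr1 mulrC mulr_natr cos2pi sin2pi. Qed.

Lemma turn_half : turn (2^-1) = -1.
Proof.
rewrite /turn mulrAC divff ?pnatr_eq0// mul1r cospi sinpi.
by apply/eqP; rewrite eq_complex /= oppr0 !eqxx.
Qed.

Lemma turn_exp n t : turn (n%:R * t) = turn t ^+ n.
Proof.
elim: n => [|n IH]; first by rewrite mul0r turn0 expr0.
by rewrite -addn1 natrD mulrDl mul1r turnD IH addn1 exprSr.
Qed.

Lemma normc_turn t : normc (turn t) = 1.
Proof. by rewrite /= cos2Dsin2 sqrtr1. Qed.

Lemma turn_neq0 t : turn t != 0.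
Proof. by rewrite -normc_gt0 normc_turn ltr01. Qed.

Let lip1 (f df : R -> R) (a b : R) : (forall x : R, is_derive x (1 : R) f (df x)) ->
  (forall x, `|df x| <= 1) -> `|f a - f b| <= `|a - b|.
Proof.
move=> fd df1; wlog ba : a b / b <= a.
  by move=> H; have [/H//|/ltW/H] := leP b a; rewrite distrC [X in _ <= X]distrC.
have [|c _ ->] := @MVT_segment _ f df b a ba (fun x _ => fd x).
  apply: continuous_subspaceT => x.
  apply: differentiable_continuous; apply/derivable1_diffP.
  by have [] := fd x.
by rewrite normrM ler_piMl.
Qed.

Lemma turn_lipschitz s t : normc (turn s - turn t) <= 4 * pi * `|s - t|.
Proof.
have e x y : `|2 * pi * x - 2 * pi * y| = 2 * pi * `|x - y| :> R.
  by rewrite -mulrBr normrM ger0_norm// mulr_ge0// pi_ge0.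
rewrite (le_trans (normc_le_ReIm _))//=.
have hc : `|cos (2 * pi * s) - cos (2 * pi * t)| <= 2 * pi * `|s - t|.
  rewrite -e; apply: (@lip1 cos (fun x => - sin x)) => x.
  by rewrite normrN sin_max.
have hs : `|sin (2 * pi * s) - sin (2 * pi * t)| <= 2 * pi * `|s - t|.
  rewrite -e; apply: (@lip1 sin cos) => x.
  exact: cos_max.
lra.
Qed.

End CircleParametrization.

Section RootsOfUnity.
Variable R : realType.

Definition root1 m : R[i] := turn (2 ^ m)%:R^-1.

Lemma root1_exp m l : root1 m ^+ l = turn (l%:R / (2 ^ m)%:R).
Proof. by rewrite turn_exp. Qed.

Lemma pow2_neq0 m : (2 ^ m)%:R != 0 :> R.
Proof. by rewrite pnatr_eq0 -lt0n expn_gt0. Qed.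

Lemma root1_prim m : (2 ^ m).-primitive_root (root1 m).
Proof.
case: m => [|m].
  have e1 : root1 0 ^+ 1 = 1 by rewrite expr1 /root1 expn0 invr1 turn1.
  by have [//|k kp] := prim_order_exists _ e1; rewrite dvdn1 => /eqP kE; rewrite kE in kp.
have full : root1 m.+1 ^+ (2 ^ m.+1) = 1 by rewrite root1_exp divff ?pow2_neq0// turn1.
have nfull : root1 m.+1 ^+ (2 ^ m) = -1.
  by rewrite root1_exp expnS natrM invfM mulrCA divff ?pow2_neq0// mulr1 turn_half.
have [|k kp] := prim_order_exists _ full; first by rewrite expn_gt0.
move=> /(dvdn_pfactor k m.+1 (isT : prime 2))[j jm kE]; suff jE : j = m.+1 by rewrite jE in kE; rewrite -kE.
apply/eqP; rewrite eqn_leq jm ltnNge; apply/negP => jlt.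
have : (k %| 2 ^ m)%N by rewrite kE dvdn_exp2l.
rewrite (prim_order_dvd kp) nfull => /eqP/eqP.
by rewrite eq_sym -addr_eq0 -[1 + 1](natrD _ 1 1) pnatr_eq0.
Qed.

Lemma root1_neq0 m : root1 m != 0.
Proof. exact: turn_neq0. Qed.

Lemma normc_root1_exp m l : normc (root1 m ^+ l) = 1.
Proof. by rewrite root1_exp normc_turn. Qed.

(** The steps of a regular polygon inscribed in the unit circle are not too
    short: a quarter of them joins antipodal points. *)
Lemma root1_step m : 8 <= (2 ^ m.+2)%:R * normc (root1 m.+2 ^+ 2 - 1).
Proof.
set w := root1 m.+2 ^+ 2.
have wm : w ^+ (2 ^ m) = -1.
  rewrite -exprM -expnS root1_exp [in (2 ^ m.+2)%N]expnS natrM invfM mulrCA.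
  by rewrite divff ?pow2_neq0// mulr1 turn_half.
have H : normc (w ^+ (2 ^ m) - 1) <= (2 ^ m)%:R * normc (w - 1).
  have : w ^+ (2 ^ m) - 1 = (w - 1) * \sum_(i < 2 ^ m) w ^+ i by exact: subrX1.
  move=> ->; rewrite normc_mul mulrC ler_wpM2r ?normc_ge0//.
  rewrite (le_trans (normc_sum _ _ _))//.
  rewrite (eq_bigr (fun=> 1)) ?sumr_const ?card_ord// => i _.
  by rewrite /w -exprM normc_root1_exp.
have : normc (-1 - 1 : R[i]) = 2.
  by rewrite -opprD normc_opp -[1 + 1](natrD _ 1 1) normc_nat.
move: H; rewrite wm => + e2; rewrite e2 => H.
have -> : (2 ^ m.+2)%:R = 4 * (2 ^ m)%:R :> R by rewrite !expnS mulnA natrM.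
lra.
Qed.

Lemma root1_sum m j : (j < 2 ^ m)%N ->
  \sum_(l < 2 ^ m) root1 m ^+ l ^+ j = if j == 0%N then (2 ^ m)%:R else 0.
Proof.
move=> jm; have [->|j0] := eqVneq j 0%N.
  rewrite (eq_bigr (fun=> 1)) ?sumr_const ?card_ord// => i _; exact: expr0.
have w1 : root1 m ^+ j - 1 != 0.
  rewrite subr_eq0 -(prim_order_dvd (root1_prim m)).
  by apply/negP => /dvdn_leq; rewrite lt0n j0 leqNgt jm => /(_ isT).
apply: (mulfI w1); rewrite mulr0 (eq_bigr (fun l : 'I_(2 ^ m) => (root1 m ^+ j) ^+ l)).
  by rewrite -subrX1 exprAC (prim_expr_order (root1_prim m)) expr1n subrr.
by move=> l _; rewrite exprAC.
Qed.

End RootsOfUnity.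

Section CDiff.
Variable R : realType.

Lemma derivable_cdiff (h : R[i]^o -> R[i]^o) (z : R[i]^o) :
  derivable h z 1 -> cdiff_at h z.
Proof.
rewrite /derivable => /cvg_ex[D] /cvgrPdist_le hD; exists D => eps eps0.
move: (hD eps%:C%C).
rewrite ltcR => /(_ eps0)/nbhs_ballP[de /= de0 H].
have deE : de = (complex.Re de)%:C%C by rewrite RRe_real// gtr0_real.
exists (complex.Re de); first by rewrite -ltcR -deE.
move=> w wz; have [wz0|wz0] := eqVneq (w - z) 0.
  have -> : w = z by apply/eqP; rewrite -subr_eq0 wz0.
  by rewrite !subrr mulr0 subrr Normc.normc0 mulr0.
have /= := H (w - z); rewrite -ball_normE /= sub0r normrN normE deE ltcR => /(_ wz wz0).
rewrite normE lecR [_ *: 1]mulr1 subrK => {}H.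
have -> : h w - h z - D * (w - z) = - ((D - (w - z)^-1 *: (h w - h z)) * (w - z)).
  rewrite /GRing.scale /=; move: (w - z) wz0 => u u0.
  by rewrite mulrBl mulrAC mulVf// mul1r opprB.
by rewrite normc_opp normc_mul ler_wpM2r ?normc_ge0.
Qed.

End CDiff.

(** * A discrete Cauchy formula *)

Section DiscreteCauchyFormula.
Variable R : realType.

(** On the circle, the increments of the trapezoidal rule combine into a multiple
    of the node, which turns the sum into a mean over the roots of unity. *)
Lemma trap_circle (h : R[i] -> R[i]) (r : R[i]) m : let w := root1 R m in
  trap h (fun t => r * turn t) m 0 1 =
  r * (w - w^-1) / 2 * \sum_(l < 2 ^ m) h (r * w ^+ l) * w ^+ l.
Proof.
move=> w; rewrite trap_sum; have w0 : w != 0 := root1_neq0 R m.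
pose F l := h (r * w ^+ l) * w ^+ l.
have FS : \sum_(l < 2 ^ m) F l.+1 = \sum_(l < 2 ^ m) F l.
  have := @big_ord_recl _ 0 +%R (2 ^ m) (fun l : 'I_(2 ^ m).+1 => F l).
  rewrite big_ord_recr /= [F (2 ^ m)%N]/F (prim_expr_order (root1_prim R m)).
  by rewrite [F 0%N]/F expr0 addrC => /addrI.
rewrite (eq_bigr (fun l : 'I_(2 ^ m) => r * (w - 1) / 2 * F l + r * (1 - w^-1) / 2 * F l.+1)).
  rewrite big_split /= -!big_distrr /= FS -mulrDl; congr (_ * _); by field.
move=> l _; rewrite !add0r !div1r -!root1_exp -/w /edge /F exprS.
by field.
Qed.

Lemma normc_turn_scale_lipschitz (r : R) s t : 0 <= r ->
  normc (r%:C%C * turn s - r%:C%C * turn t) <= r * (4 * pi) * `|s - t|.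
Proof.
move=> r0; rewrite -mulrBr normc_mul normc_real ger0_norm// -mulrA ler_wpM2l//.
exact: turn_lipschitz.
Qed.

(** The circle and its image under a small homothety of centre [z] bound an
    annulus, the image of the unit square under [cone]. Goursat's lemma applies
    there to the difference quotient at [z]; over the small loop the quotient
    is bounded and the loop is short. *)
Lemma trap_quotient_small (g : R[i]^o -> R[i]^o) (z : R[i]) (r : R) :
  (forall x, derivable g x 1) -> normc z < r ->
  forall eps, 0 < eps -> exists M, forall m, (M <= m)%N ->
  normc (trap (fun w => (g w - g z) / (w - z)) (fun t => r%:C%C * turn t) m 0 1) < eps.
Proof.
move=> dg zr eps eps0; pose h (w : R[i]) := (g w - g z) / (w - z); pose ga t := r%:C%C * turn t.
have r0 : 0 < r by rewrite (le_lt_trans _ zr)// normc_ge0.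
have [D hD] := derivable_cdiff (dg z).
have [de de0 {}hD] := hD 1 ltr01.
pose B := normc D + 1.
have B0 : 0 < B by rewrite ltr_wpDl// normc_ge0.
have hB w : normc (w - z) < de -> normc (h w) <= B.
  move=> wz; have [wz0|wz0] := eqVneq (w - z) 0.
    by rewrite /h wz0 invr0 mulr0 Normc.normc0 ltW.
  rewrite /h normc_mul normc_inv ler_pdivrMr ?normc_gt0//.
  have := hD w wz; rewrite mul1r => H.
  rewrite -[g w - g z](subrK (D * (w - z))) (le_trans (normcD_le _ _))//.
  by rewrite mulrDl mul1r addrC normc_mul lerD2l.
pose P := r * (4 * pi).
have P0 : 0 < P by rewrite !mulr_gt0// pi_gt0.
have gaL s t : normc (ga s - ga t) <= P * `|s - t|.
  by rewrite /ga /P; apply: normc_turn_scale_lipschitz; exact: ltW.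
have gaz t : normc (ga t - z) <= 2 * r.
  rewrite (le_trans (normcB_le _ _))// normc_mul normc_turn normc_real mulr1 gtr0_norm//.
  lra.
(* The small loop must stay where the difference quotient is bounded by [B], and
   its length times [B] must not exceed [eps / 2]. *)
have [s0 [s00 s01 s0de s0e]] : exists s0 : R, [/\ 0 < s0, s0 <= 1, s0 * (2 * r) < de
    & B * (s0 * P) <= eps / 2].
  pose a := de / (4 * r); pose b := eps / (2 * B * P).
  have a0 : 0 < a by rewrite divr_gt0// mulr_gt0.
  have b0 : 0 < b by rewrite divr_gt0// mulr_gt0// mulr_gt0.
  have ha : a * (2 * r) < de.
    have -> : a * (2 * r) = de / 2 by rewrite /a; field; rewrite gt_eqF.
    lra.
  have hb : B * (b * P) = eps / 2 by rewrite /b; field; rewrite !gt_eqF.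
  exists (Num.min 1 (Num.min a b)); split.
  - by rewrite !lt_min ltr01 a0.
  - by rewrite ge_min lexx.
  - by rewrite (le_lt_trans _ ha)// ler_wpM2r ?mulr_ge0 ?(ltW r0)// !ge_min lexx orbT.
  - rewrite -hb ler_wpM2l ?(ltW B0)// ler_wpM2r ?(ltW P0)//.
    by rewrite !ge_min lexx !orbT.
pose c (u : R) := (s0 + (1 - s0) * u)%:C%C : R[i].
have c01 u : 0 <= u <= 1 -> s0 <= s0 + (1 - s0) * u <= 1.
  by move=> u01; rewrite lerDl mulr_ge0//=; nra.
pose cone u t := z + c u * (ga t - z).
pose L := 2 * r + P.
have L0 : 0 < L by rewrite addr_gt0// mulr_gt0.
have coneL u u' v v' : 0 <= u <= 1 -> 0 <= u' <= 1 -> 0 <= v <= 1 -> 0 <= v' <= 1 ->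
    normc (cone u v - cone u' v') <= L * (`|u - u'| + `|v - v'|).
  move=> u01 u01' _ _.
  have -> : cone u v - cone u' v' = (c u - c u') * (ga v - z) + c u' * (ga v - ga v').
    by rewrite /cone; ring.
  have h1 : normc (c u - c u') <= `|u - u'|.
    have -> : c u - c u' = ((1 - s0) * (u - u'))%:C%C by rewrite -rmorphB; congr (_%:C%C); ring.
    rewrite normc_real normrM ler_piMl// ger0_norm; lra.
  have h2 : normc (c u') <= 1.
    by rewrite normc_real ger0_norm; have := c01 u' u01'; lra.
  rewrite (le_trans (normcD_le _ _))// !normc_mul.
  have h3 : normc (c u - c u') * normc (ga v - z) <= `|u - u'| * (2 * r).
    by rewrite ler_pM ?normc_ge0.
  have h4 : normc (c u') * normc (ga v - ga v') <= 1 * (P * `|v - v'|).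
    by rewrite ler_pM ?normc_ge0.
  rewrite (le_trans (lerD h3 h4))// /L.
  have := mulr_ge0 (ltW P0) (normr_ge0 (u - u')).
  have := mulr_ge0 (ltW r0) (normr_ge0 (v - v')).
  lra.
have hdiff w : w != z -> cdiff_at h w.
  move=> wz; apply: derivable_cdiff.
  apply: derivableM.
    by apply: derivableB; [exact: dg|exact: derivable_cst].
  apply: derivableV; first by rewrite subr_eq0.
  by apply: derivableB; [exact: derivable_id|exact: derivable_cst].
have cone_neq u v : 0 <= u <= 1 -> cone u v != z.
  move=> u01; rewrite -subr_eq0 /cone addrAC subrr add0r mulf_neq0//.
    by rewrite -normc_gt0 normc_real normr_gt0 gt_eqF//; have := c01 u u01; lra.
  rewrite subr_eq0; apply/eqP => ez; move: zr.
  by rewrite -ez normc_mul normc_turn normc_real mulr1 gtr0_norm// ltxx.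
have e20 : 0 < eps / 2 by lra.
have [M HM] := goursat L0 coneL (fun u v u01 _ => hdiff _ (cone_neq u v u01)) e20.
exists M => m Mm; have := HM m Mm.
have c1 : c 1 = 1 by rewrite /c mulr1 addrCA subrr addr0.
have -> : circulation h cone m 0 0 1 = trap h ga m 0 1 - trap h (cone 0) m 0 1.
  rewrite /circulation !add0r.
  have -> : trap h (cone^~ 1) m 0 1 = trap h (cone^~ 0) m 0 1.
    by apply: eq_trap => // u; rewrite /cone /ga turn0 turn1.
  have -> : trap h (cone 1) m 0 1 = trap h ga m 0 1.
    by apply: eq_trap => // t; rewrite /cone c1 mul1r addrC subrK.
  by ring.
move=> H1.
have H2 : normc (trap h (cone 0) m 0 1) <= B * (s0 * P) * 1.
  have c0 : c 0 = s0%:C%C by rewrite /c mulr0 addr0.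
  apply: trap_bound; rewrite ?ler01 ?(ltW B0)//.
  - move=> u v _ _; have -> : cone 0 u - cone 0 v = s0%:C%C * (ga u - ga v).
      by rewrite /cone c0; ring.
    by rewrite normc_mul normc_real gtr0_norm// -mulrA ler_pM2l.
  - move=> u _; apply: hB; rewrite /cone c0 addrAC subrr add0r.
    rewrite normc_mul normc_real gtr0_norm// (le_lt_trans _ s0de)//.
    by rewrite ler_pM2l.
change (normc (trap h ga m 0 1) < eps).
rewrite -[trap h ga m 0 1](subrK (trap h (cone 0) m 0 1)).
rewrite (le_lt_trans (normcD_le _ _))//; lra.
Qed.

(** The factor between the two sums does not degenerate as [m] grows, by
    [root1_step]. *)
Lemma mean_quotient_small (g : R[i]^o -> R[i]^o) (z : R[i]) (r : R) :
  (forall x, derivable g x 1) -> normc z < r ->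
  forall eps, 0 < eps -> exists M, forall m, (M <= m)%N ->
  normc ((2 ^ m)%:R^-1 * \sum_(l < 2 ^ m) (g (r%:C%C * root1 R m ^+ l) - g z) /
    (r%:C%C * root1 R m ^+ l - z) * root1 R m ^+ l) < eps.
Proof.
move=> dg zr eps eps0.
have r0 : 0 < r by rewrite (le_lt_trans _ zr)// normc_ge0.
have er0 : 0 < eps * r by rewrite mulr_gt0.
have [M HM] := trap_quotient_small dg zr er0.
exists (maxn M 2) => m Mm2.
have /andP[Mm m2] : (M <= m)%N && (2 <= m)%N by rewrite -geq_max.
have := HM m Mm; rewrite trap_circle.
set S := \sum_(l < _) _; set w := root1 R m.
have N0 := pow2_neq0 R m; have Ngt : 0 < (2 ^ m)%:R :> R by rewrite lt_def N0 ler0n.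
have w0 : w != 0 := root1_neq0 R m.
have step : 8 <= (2 ^ m)%:R * normc (w - w^-1).
  have [k mk] : exists k, m = k.+2 by exists m.-2; lia.
  have := root1_step R k; rewrite -mk -/w.
  have -> : w - w^-1 = (w ^+ 2 - 1) / w by field.
  by rewrite normc_mul normc_inv -[w]expr1 normc_root1_exp invr1 mulr1.
rewrite !normc_mul normc_real gtr0_norm// !normc_inv !normc_nat => H.
rewrite ltr_pdivrMl//.
have nS := normc_ge0 S.
have H' : r * (normc (w - w^-1) / 2 * normc S) < r * eps by rewrite mulrA [r * eps]mulrC mulrA.
rewrite ltr_pM2l// in H'; set a := normc (w - w^-1) in H' step *.
have a0 : 0 <= a := normc_ge0 _.
set N := (2 ^ m)%:R in step Ngt *.
have := ler_wpM2r nS step.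
have -> : N * a * normc S = 2 * (N * (a / 2 * normc S)) by field.
have : N * (a / 2 * normc S) < N * eps by rewrite ltr_pM2l.
lra.
Qed.

Definition gsum (N : nat) (u : R[i]) : R[i] := \sum_(j < N) u ^+ j.

Lemma gsumS N (u : R[i]) : gsum N.+1 u = 1 + u * gsum N u.
Proof.
rewrite /gsum big_ord_recl expr0 big_distrr /=; congr (_ + _).
by apply: eq_bigr => j _; rewrite exprS.
Qed.

(** Together with [gsum_lipschitz], this makes the means equicontinuous in [z]
    on the disc of half the radius, uniformly in the number of nodes. *)
Lemma gsum_bound N (u : R[i]) : normc u <= 2^-1 -> normc (gsum N u) <= 2.
Proof.
move=> u2; elim: N => [|N IH]; first by rewrite /gsum big_ord0 Normc.normc0.
rewrite gsumS (le_trans (normcD_le _ _))// Normc.normc1 normc_mul.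
have : normc u * normc (gsum N u) <= 2^-1 * 2 by rewrite ler_pM ?normc_ge0.
by rewrite mulVf// => ?; lra.
Qed.

Lemma gsum_lipschitz N (u v : R[i]) : normc u <= 2^-1 -> normc v <= 2^-1 ->
  normc (gsum N u - gsum N v) <= 4 * normc (u - v).
Proof.
move=> u2 v2; elim: N => [|N IH].
  by rewrite /gsum !big_ord0 subrr Normc.normc0 mulr_ge0// normc_ge0.
rewrite !gsumS.
have -> : 1 + u * gsum N u - (1 + v * gsum N v) =
  u * (gsum N u - gsum N v) + (u - v) * gsum N v by ring.
rewrite (le_trans (normcD_le _ _))// !normc_mul.
have : normc u * normc (gsum N u - gsum N v) <= 2^-1 * (4 * normc (u - v)).
  by rewrite ler_pM ?normc_ge0.
have : normc (u - v) * normc (gsum N v) <= normc (u - v) * 2.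
  by rewrite ler_wpM2l ?normc_ge0// gsum_bound.
lra.
Qed.

(** The discrete Cauchy integral over the circle of radius [r]: up to a factor
    [1 - (z / r) ^ N], it is the trapezoidal rule for the integral of
    [g zeta / (zeta - z)], and it is a polynomial in [z]. *)
Definition cauchy_mean (g : R[i] -> R[i]) (r : R) (m : nat) (z : R[i]) : R[i] :=
  (2 ^ m)%:R^-1 * \sum_(l < 2 ^ m)
    g (r%:C%C * root1 R m ^+ l) * gsum (2 ^ m) (z / (r%:C%C * root1 R m ^+ l)).

(** For constant [g] the formula is exact up to the factor [1 - (z / r) ^+ N], by
    orthogonality of the powers of a primitive root of unity. The remaining
    mean is that of the difference quotient at [z]. *)
Lemma cauchy_mean_cvg (g : R[i]^o -> R[i]^o) (z : R[i]) (r : R) :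
  (forall x, derivable g x 1) -> normc z < r ->
  forall eps, 0 < eps -> exists M, forall m, (M <= m)%N ->
  normc (cauchy_mean g r m z - g z) < eps.
Proof.
move=> dg zr eps eps0.
have r0 : 0 < r by rewrite (le_lt_trans _ zr)// normc_ge0.
have e20 : 0 < eps / (2 * r) by rewrite divr_gt0// mulr_gt0.
have [M HM] := mean_quotient_small dg zr e20; exists M => m Mm.
have := HM m Mm; set w := root1 R m => /=.
set rC := r%:C%C; set N := (2 ^ m)%N.
have rC0 : rC != 0 by rewrite -normc_gt0 normc_real normr_gt0 gt_eqF.
have w0 l : w ^+ l != 0 by rewrite expf_neq0// root1_neq0.
have NC0 : N%:R != 0 :> R[i] by rewrite pnatr_eq0 -lt0n expn_gt0.
have zeta0 l : rC * w ^+ l - z != 0.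
  rewrite subr_eq0; apply/eqP => ez; move: zr.
  by rewrite -ez normc_mul normc_root1_exp normc_real mulr1 gtr0_norm// ltxx.
have wN l : (w ^+ l) ^+ N = 1.
  by rewrite exprAC (prim_expr_order (root1_prim R m)) expr1n.
have gsumE l : gsum N (z / (rC * w ^+ l)) =
    (1 - (z / rC) ^+ N) * (w ^+ l * rC / (rC * w ^+ l - z)).
  set u := z / (rC * w ^+ l).
  have uE : u ^+ N = (z / rC) ^+ N by rewrite /u invfM mulrA exprMn exprVn wN invr1 mulr1.
  have u1 : u - 1 = (z - rC * w ^+ l) / (rC * w ^+ l).
    by rewrite mulrBl divff// mulf_neq0.
  have zl : z - rC * w ^+ l != 0 by rewrite -opprB oppr_eq0.
  have u10 : u - 1 != 0 by rewrite u1 mulf_neq0// invr_neq0// mulf_neq0.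
  apply: (mulfI u10); rewrite -subrX1 uE u1.
  field; rewrite ?rC0 ?w0 ?zeta0//.
have one : \sum_(l < N) gsum N (z / (rC * w ^+ l)) = N%:R.
  rewrite /gsum exchange_big /=.
  rewrite (bigD1 (Ordinal (expn_gt0 2 m : (0 < N)%N)))//= [X in _ + X]big1 => [|j j0].
    by rewrite addr0 (eq_bigr (fun=> 1)) ?sumr_const ?card_ord// => i _; rewrite expr0.
  rewrite (eq_bigr (fun l : 'I_N => (z / rC) ^+ j * w ^- l ^+ j)); last first.
    by move=> l _; rewrite invfM mulrA exprMn exprVn.
  rewrite -big_distrr /=.
  have -> : \sum_(l < N) w ^- l ^+ j = (\sum_(l < N) w ^+ l ^+ j)^*%C.
    rewrite rmorph_sum; apply: eq_bigr => l _ /=.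
    have wn : `|w ^+ l| = 1 by rewrite normE normc_root1_exp.
    by rewrite rmorphXn /= invc_norm wn expr1n invr1 mul1r.
  rewrite root1_sum//; case: eqP => [jE|_]; last by rewrite rmorph0 mulr0.
  by move: j0; rewrite -val_eqE /= jE.
have -> : cauchy_mean g r m z - g z = (1 - (z / rC) ^+ N) * rC * (N%:R^-1 *
    \sum_(l < N) (g (rC * w ^+ l) - g z) / (rC * w ^+ l - z) * w ^+ l).
  have -> : cauchy_mean g r m z - g z =
      N%:R^-1 * \sum_(l < N) (g (rC * w ^+ l) - g z) * gsum N (z / (rC * w ^+ l)).
    under eq_bigr do rewrite mulrBl.
    rewrite sumrB -big_distrr /= one /cauchy_mean mulrBr; congr (_ - _).
    by field.
  rewrite [RHS]mulrCA; congr (_ * _); rewrite big_distrr /=.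
  apply: eq_bigr => l _; rewrite gsumE; field.
  exact: zeta0.
set S := N%:R^-1 * _ => HS; rewrite normc_mul normc_mul normc_real gtr0_norm//.
have z1 : normc (1 - (z / rC) ^+ N) <= 2.
  rewrite (le_trans (normcB_le _ _))// Normc.normc1 -[leRHS](natrD _ 1 1) lerD2l.
  rewrite normc_exp exprn_ile1 ?normc_ge0// normc_mul normc_inv normc_real gtr0_norm//.
  by rewrite ler_pdivrMr// mul1r ltW.
have -> : eps = 2 * r * (eps / (2 * r)) by field; rewrite gt_eqF.
apply: le_lt_trans (_ : 2 * r * normc S < _).
  by rewrite ler_wpM2r ?normc_ge0// ler_wpM2r// ltW.
by rewrite ltr_pM2l// mulr_gt0.
Qed.

End DiscreteCauchyFormula.

(** * Multi-indices and the square order *)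

Lemma sum_zero_tail {V : nmodType} (F : nat -> V) L L' : (L <= L')%N ->
  (forall k, (L <= k)%N -> F k = 0) -> \sum_(k < L) F k = \sum_(k < L') F k.
Proof.
move=> LL' F0; rewrite (big_ord_widen L' F LL') big_mkcond /=; apply: eq_bigr => k _.
by case: ltnP => // /F0.
Qed.

Section MultiindexSupport.
Implicit Types a b : multiindex.

Definition mon {K : comNzRingType} (l : nat -> K) (a : multiindex) : K :=
  \prod_(j <- finsupp a) l j ^+ a j.

Lemma mlen_le (a : multiindex) n : (forall j, (n <= j)%N -> a j = 0%N) -> (mlen a <= n)%N.
Proof.
move=> an; apply/bigmax_leqP_seq => j; rewrite mem_finsupp => aj _.
by rewrite ltnNge; apply: contra aj => /an ->.
Qed.

Lemma mlen_eq0 (a : multiindex) j : (mlen a <= j)%N -> a j = 0%N.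
Proof.
move=> aj; apply/eqP; apply: contraTT aj; rewrite -mem_finsupp -ltnNge => ja.
exact: (@leq_bigmax_seq _ (enum_fset (finsupp a)) xpredT succn j ja isT).
Qed.

Lemma big_finsupp (T : Type) (idx : T) (op : Monoid.com_law idx) (a : multiindex)
    (F : nat -> T) n : (mlen a <= n)%N -> (forall j, a j = 0%N -> F j = idx) ->
  \big[op/idx]_(j <- finsupp a) F j = \big[op/idx]_(j < n) F j.
Proof.
move=> an F0; rewrite -(big_mkord xpredT F) /index_iota subn0.
rewrite [RHS](bigID (fun j => j \in finsupp a)) /= [X in op _ X]big1 ?Monoid.mulm1; last first.
  by move=> j; rewrite mem_finsupp negbK => /eqP/F0.
rewrite -[RHS]big_filter; apply: perm_big; apply: uniq_perm.
- exact: fset_uniq.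
- by rewrite filter_uniq// iota_uniq.
- move=> j; rewrite mem_filter mem_iota /= add0n; case: (boolP (j \in finsupp a)) => //=.
  rewrite mem_finsupp => aj; apply/esym; rewrite ltnNge; apply: contra aj => nj.
  by rewrite mlen_eq0// (leq_trans an nj).
Qed.

Lemma monE {K : comNzRingType} (l : nat -> K) a n : (mlen a <= n)%N ->
  mon l a = \prod_(j < n) l j ^+ a j.
Proof. by move=> an; apply: big_finsupp => // j ->; rewrite expr0. Qed.

Lemma mdegreeE a n : (mlen a <= n)%N -> mdegree a = (\sum_(j < n) a j)%N.
Proof. by move=> an; apply: big_finsupp. Qed.

Lemma leq_mdegree a j : (a j <= mdegree a)%N.
Proof.
have [ja|/mlen_eq0 -> //] := ltnP j (mlen a).
by rewrite (mdegreeE (leqnn _)) (bigD1 (Ordinal ja))//= leq_addr.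
Qed.

Lemma monM {K : comNzRingType} (l l' : nat -> K) a :
  mon (fun j => l j * l' j) a = mon l a * mon l' a.
Proof. by rewrite -big_split /=; apply: eq_bigr => j _; rewrite exprMn. Qed.

Lemma mon_const {K : comNzRingType} (c : K) a : mon (fun=> c) a = c ^+ mdegree a.
Proof. by rewrite /mon /mdegree -expr_sum. Qed.

Lemma mon_single {K : comNzRingType} (c : K) i a :
  mon (fun j => if j == i then c else 1) a = c ^+ a i.
Proof.
have [ia|/mlen_eq0 ai] := ltnP i (mlen a).
  rewrite (monE _ (leqnn _)) (bigD1 (Ordinal ia))//= eqxx big1 ?mulr1// => j.
  by rewrite -val_eqE /= => /negPf ->; rewrite expr1n.
rewrite ai expr0 /mon big1_seq// => j /andP[_]; rewrite mem_finsupp /=.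
by have [->|ji _] := eqVneq j i; [rewrite ai|rewrite expr1n].
Qed.

Definition mzero : multiindex := [fsfun].
Definition mshift i a : multiindex := [fsfun a with i |-> (a i).+1].

Lemma mon0 {K : comNzRingType} (l : nat -> K) : mon l mzero = 1.
Proof. by rewrite (@monE K l _ 0) ?big_ord0//; apply: mlen_le => j _; rewrite fsfunE. Qed.

Lemma mon_shift {K : comNzRingType} (l : nat -> K) i a : mon l (mshift i a) = l i * mon l a.
Proof.
pose n := maxn i.+1 (mlen a).
have an : (mlen a <= n)%N by rewrite leq_maxr.
have ni : (i < n)%N by rewrite leq_maxl.
have sn : (mlen (mshift i a) <= n)%N.
  apply: mlen_le => j nj; rewrite fsfun_withE.
  by case: eqP => [ji|_]; [rewrite ji leqNgt ni in nj|rewrite mlen_eq0// (leq_trans an)].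
rewrite (monE l an) (monE l sn) (bigD1 (Ordinal ni))//= [in RHS](bigD1 (Ordinal ni))//=.
rewrite fsfun_with exprS mulrA; congr (_ * _); apply: eq_bigr => j.
by rewrite -val_eqE /= fsfun_withE => /negPf ->.
Qed.

(** The colexicographic order on the first [n] exponents, by recursion from the
    last one downwards; the induction in [colex_sum_bound] follows it. *)
Fixpoint colex n (a b : multiindex) : bool :=
  if n is k.+1 then (a k < b k)%N || ((a k == b k) && colex k a b) else false.

(** Comparing lengths first adds nothing to the colexicographic order: at the last
    index of the longer multi-index the shorter one has exponent 0. *)
Lemma colexP n a b : (mlen a <= n)%N -> (mlen b <= n)%N ->
  reflect (square_lt a b) (colex n a b).
Proof.
move=> an bn; apply: (iffP idP).
  have {an bn} : forall i, (n <= i)%N -> a i = b i.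
    by move=> i ni; rewrite !mlen_eq0// (leq_trans _ ni).
  elim: n => // n IH ab /= /orP[lt|/andP[/eqP eq /IH]]; last first.
    by apply=> i; rewrite leq_eqVlt => /predU1P[<-|/ab].
  have [lab|lba|eab] := ltngtP (mlen a) (mlen b); [by left| |by right; split; last exists n].
  have nb : (n < mlen b)%N.
    by rewrite ltnNge; apply/negP => /mlen_eq0 b0; rewrite b0 in lt.
  have /negP[] : ~~ (mlen b < mlen a)%N; last by [].
  rewrite -leqNgt; apply: mlen_le => j bj; rewrite ab ?mlen_eq0//.
  exact: leq_trans nb bj.
suff H : (exists2 j, (a j < b j)%N & forall i, (j < i)%N -> a i = b i) -> colex n a b.
  case=> [lt|[_ ?]]; apply: H => //.
  exists (mlen b).-1; last first.
    move=> i bi; have bi' : (mlen b <= i)%N by lia.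
    by rewrite !mlen_eq0// (leq_trans (ltnW lt)).
  rewrite mlen_eq0 ?lt0n; last by lia.
  apply/eqP => b0; suff : (mlen b <= (mlen b).-1)%N by lia.
  apply: mlen_le => j; rewrite leq_eqVlt => /predU1P[<-//|bj].
  by rewrite mlen_eq0//; lia.
move=> [j jab ij].
have : (j < n)%N by rewrite ltnNge; apply/negP => nj; rewrite (mlen_eq0 (leq_trans bn nj)) in jab.
elim: n {an bn} => // n IH; rewrite ltnS leq_eqVlt => /predU1P[<-|jn] /=.
  by rewrite jab.
by rewrite ij// eqxx IH ?orbT.
Qed.

End MultiindexSupport.

(** * Partial sums in the square order *)

Section Averages.
Variable R : realType.
Implicit Types (x : nat -> R[i]).

(** Averaging over the [2 ^ m]-th roots of unity isolates the terms of one
    given weight without increasing the bound. *)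
Lemma weight_part_bound m L x (c : nat -> nat) (v : nat) (M : R) :
  (forall k, (k < L)%N -> (c k < 2 ^ m)%N) ->
  (forall s, normc (\sum_(k < L) root1 R m ^+ s ^+ c k * x k) <= M) ->
  normc (\sum_(k < L) if c k == v then x k else 0) <= M.
Proof.
move=> cm xM; set w := root1 R m; set N := (2 ^ m)%N.
have M0 : 0 <= M by rewrite (le_trans _ (xM 0%N)) ?normc_ge0.
have N0 : (N%:R : R[i]) != 0 by rewrite pnatr_eq0 -lt0n expn_gt0.
have Ngt : 0 < N%:R :> R by rewrite ltr0n expn_gt0.
have w0 : w != 0 := root1_neq0 R m.
have [vN|Nv] := ltnP v N; last first.
  rewrite big1 ?Normc.normc0// => k _; case: eqP => // ck.
  by have := cm k (ltn_ord k); rewrite ck ltnNge Nv.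
have wN : w ^+ N = 1 := prim_expr_order (root1_prim R m).
have -> : \sum_(k < L) (if c k == v then x k else 0) =
    N%:R^-1 * \sum_(s < N) w ^+ s ^+ (N - v) * \sum_(k < L) w ^+ s ^+ c k * x k.
  under [in RHS]eq_bigr do rewrite big_distrr /=.
  rewrite exchange_big /= big_distrr /=; apply: eq_bigr => k _.
  under eq_bigr do rewrite mulrA.
  rewrite -big_distrl /= mulrA.
  have -> : \sum_(s < N) w ^+ s ^+ (N - v) * w ^+ s ^+ c k =
            \sum_(s < N) w ^+ s ^+ ((c k + (N - v)) %% N).
    apply: eq_bigr => s _; rewrite -exprD addnC -!exprM ![(s * _)%N]mulnC !exprM.
    by rewrite (prim_expr_mod (root1_prim R m)).
  rewrite root1_sum ?ltn_pmod ?expn_gt0//.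
  have ck := cm k (ltn_ord k).
  have -> : ((c k + (N - v)) %% N == 0)%N = (c k == v).
    have [cv|cv] := leqP (c k) v.
      have [->|ne] := eqVneq (c k) v; first by rewrite subnKC ?modnn// ltnW.
      rewrite modn_small; last by move/eqP: ne; rewrite /N; lia.
      by move/eqP: ne => ?; apply/negbTE; rewrite /N in vN *; lia.
    have -> : (c k + (N - v) = N + (c k - v))%N by rewrite /N in vN *; lia.
    rewrite modnDl modn_small ?subn_eq0; last by rewrite /N; lia.
    by rewrite leqNgt cv gtn_eqF.
  by case: eqP => _; rewrite ?mulr0 ?mul0r// mulVf// mul1r.
rewrite normc_mul normc_inv normc_nat ler_pdivrMl//.
rewrite (le_trans (normc_sum _ _ _))//.
rewrite (le_trans (_ : _ <= \sum_(s < N) M))//; last by rewrite sumr_const card_ord mulr_natl.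
by apply: ler_sum => s _; rewrite normc_mul -exprM normc_root1_exp mul1r.
Qed.

End Averages.

Section PartialSums.
Variables (R : realType) (alpha : nat -> multiindex) (m L : nat).
Hypothesis alpha_small : forall k, (k < L)%N -> (mdegree (alpha k) < 2 ^ m)%N.

Definition root_valued (l : nat -> R[i]) := forall j, exists s, l j = root1 R m ^+ s.

(** In this section [b k] stands for the value of the [k]-th term of a polynomial
    at a fixed point, and the sum of the [b k * mon l (alpha k)] for its value
    at the point with coordinates multiplied by [l]. *)
Definition roots_bounded (b : nat -> R[i]) (M : R) := forall l, root_valued l ->
  normc (\sum_(k < L) b k * mon l (alpha k)) <= M.

Lemma roots_bounded_exponent b M i v : roots_bounded b M ->
  roots_bounded (fun k => if alpha k i == v then b k else 0) M.
Proof.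
move=> bM l lr.
rewrite (eq_bigr (fun k : 'I_L => if alpha k i == v then b k * mon l (alpha k) else 0)).
  apply: (@weight_part_bound _ m L (fun k => b k * mon l (alpha k)) (fun k => alpha k i)).
    by move=> k kL; rewrite (leq_ltn_trans (leq_mdegree _ _))// alpha_small.
  move=> s; have := bM (fun j => (if j == i then root1 R m ^+ s else 1) * l j).
  rewrite (eq_bigr (fun k : 'I_L => root1 R m ^+ s ^+ alpha k i * (b k * mon l (alpha k)))).
    apply=> j; have [t lj] := lr j; case: eqP => _.
      by exists (s + t)%N; rewrite lj exprD.
    by exists t; rewrite mul1r.
  by move=> k _; rewrite monM mon_single mulrCA.
by move=> k _; case: eqP => _; rewrite ?mul0r.
Qed.

Lemma roots_bounded_degree (c : R) b M d : 0 < c ->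
  roots_bounded (fun k => b k * c%:C%C ^+ mdegree (alpha k)) M ->
  roots_bounded (fun k => if mdegree (alpha k) == d then b k else 0) (M / c ^+ d).
Proof.
move=> c0 bM l lr; rewrite ler_pdivlMr ?exprn_gt0//.
have -> : c ^+ d = normc (c%:C%C ^+ d) by rewrite normc_exp normc_real gtr0_norm.
rewrite -normc_mul big_distrl /=.
rewrite (eq_bigr (fun k : 'I_L => if mdegree (alpha k) == d then
    b k * c%:C%C ^+ mdegree (alpha k) * mon l (alpha k) else 0)).
  apply: (@weight_part_bound _ m L
    (fun k => b k * c%:C%C ^+ mdegree (alpha k) * mon l (alpha k))
    (fun k => mdegree (alpha k))) => // s.
  have := bM (fun j => root1 R m ^+ s * l j).
  rewrite (eq_bigr (fun k : 'I_L => root1 R m ^+ s ^+ mdegree (alpha k) *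
     (b k * c%:C%C ^+ mdegree (alpha k) * mon l (alpha k)))).
    by apply=> j; have [t lj] := lr j; exists (s + t)%N; rewrite lj exprD.
  by move=> k _; rewrite monM mon_const mulrCA.
by move=> k _; case: eqP => [->|_]; rewrite ?mul0r// mulrAC.
Qed.

Lemma roots_bounded_sum b M : roots_bounded b M -> normc (\sum_(k < L) b k) <= M.
Proof.
have r1 : root_valued (fun=> 1) by move=> j; exists 0%N; rewrite expr0.
move=> /(_ _ r1); rewrite (eq_bigr (fun k : 'I_L => b k))// => k _.
by rewrite mon_const expr1n mulr1.
Qed.

(** An initial segment of the colexicographic order below [beta] is a disjoint
    union of sets that prescribe the exponents from some position on. There are
    [beta j] of them for each position [j], and prescribing exponents does not
    increase the bound. *)
Lemma colex_sum_bound n beta b M : roots_bounded b M ->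
  normc (\sum_(k < L) if colex n (alpha k) beta then b k else 0) <=
  (\sum_(j < n) beta j)%:R * M.
Proof.
elim: n b => [|n IH] b bM.
  by rewrite !big_ord0 mul0r big1 ?Normc.normc0.
rewrite big_ord_recr /= natrD mulrDl addrC.
have -> : \sum_(k < L) (if (alpha k n < beta n)%N || ((alpha k n == beta n) && colex n (alpha k) beta)
      then b k else 0) =
    \sum_(v < beta n) (\sum_(k < L) if alpha k n == v then b k else 0) +
    \sum_(k < L) if colex n (alpha k) beta then (if alpha k n == beta n then b k else 0) else 0.
  rewrite exchange_big /= -big_split /=; apply: eq_bigr => k _.
  have [lt|gt|eq] := ltngtP (alpha k n) (beta n) => /=.
  - rewrite (bigD1 (Ordinal lt))//= eqxx big1 ?addr0; last first.
      by move=> i; rewrite -val_eqE /= eq_sym => /negPf ->.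
    by case: ifP => _; rewrite addr0.
  - rewrite big1 ?add0r; last by move=> i _; rewrite gtn_eqF// (ltn_trans (ltn_ord i)).
    by case: ifP.
  - rewrite big1 ?add0r; last by move=> i _; rewrite eq gtn_eqF.
    by case: ifP.
rewrite (le_trans (normcD_le _ _))// lerD//.
  rewrite (le_trans (normc_sum _ _ _))//.
  rewrite (le_trans (_ : _ <= \sum_(v < beta n) M))//.
    apply: ler_sum => v _.
    apply: (@roots_bounded_sum (fun k => if alpha k n == v then b k else 0)).
    exact: roots_bounded_exponent.
  by rewrite sumr_const card_ord mulr_natl.
apply: (IH (fun k => if alpha k n == beta n then b k else 0)).
exact: roots_bounded_exponent.
Qed.

End PartialSums.

Section SquareOrderPartialSums.
Variables (R : realType) (alpha : nat -> multiindex).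
Hypothesis calpha : compatible alpha.

(** A compatible ordering lists each degree increasingly, so that the first index
    of degree [d] that is not below [N], if there is one, serves as [p]. *)
Lemma degree_initial_segment (N d : nat) :
  (forall k, mdegree (alpha k) = d -> (k < N)%N) \/
  exists2 p, mdegree (alpha p) = d &
    forall k, mdegree (alpha k) = d -> (k < N)%N <-> square_lt (alpha k) (alpha p).
Proof.
have [[p0 /andP[Np0 dp0]]|no] := pselect (exists p, (N <= p)%N && (mdegree (alpha p) == d)).
  have ex : exists p, (N <= p)%N && (mdegree (alpha p) == d) by exists p0; rewrite Np0.
  right; case: (ex_minnP ex) => p /andP[Np /eqP dp] pmin; exists p => // k dk.
  rewrite -(calpha.2 k p) ?dk ?dp//; split=> [kN|kp]; first exact: leq_trans kN Np.
  rewrite ltnNge; apply/negP => Nk.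
  by have := pmin k; rewrite Nk dk eqxx => /(_ isT); rewrite leqNgt kp.
left=> k dk; rewrite ltnNge; apply/negP => Nk; apply: no; exists k.
by rewrite Nk dk eqxx.
Qed.

Lemma degree_sum_bound m L b (M : R) d N :
  (forall k, (k < L)%N -> (mdegree (alpha k) < 2 ^ m)%N) ->
  roots_bounded alpha m L (fun k => if mdegree (alpha k) == d then b k else 0) M ->
  normc (\sum_(k < L) if (mdegree (alpha k) == d) && (k < N)%N then b k else 0)
  <= (d.+1)%:R * M.
Proof.
move=> small bM; have M0 : 0 <= M.
  by rewrite (le_trans _ (roots_bounded_sum bM))// normc_ge0.
have [all|[p dp seg]] := degree_initial_segment N d.
  apply: le_trans (_ : M <= _); last by rewrite ler_peMl// ler1n.
  rewrite (eq_bigr (fun k : 'I_L => if mdegree (alpha k) == d then b k else 0)).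
    exact: (roots_bounded_sum bM).
  by move=> k _; case: eqP => //= /all ->.
pose n := (maxn (mlen (alpha p)) (\max_(k < L) mlen (alpha k)))%N.
have pn : (mlen (alpha p) <= n)%N by rewrite leq_maxl.
have kn (k : 'I_L) : (mlen (alpha k) <= n)%N.
  by rewrite (leq_trans _ (leq_maxr _ _))// (leq_bigmax k).
apply: le_trans (_ : d%:R * M <= _); last by rewrite ler_wpM2r// ler_nat.
rewrite -[in X in X%:R]dp (mdegreeE pn).
rewrite (le_trans _ (colex_sum_bound small n (alpha p) bM))//.
rewrite le_eqVlt (eq_bigr (fun k : 'I_L => if colex n (alpha k) (alpha p) then
  (if mdegree (alpha k) == d then b k else 0) else 0)) ?eqxx// => k _.
case: eqP => [dk|_] /=; last by case: ifP.
by congr (if _ then _ else _); apply/idP/(colexP (kn k) pn) => /(seg _ dk).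
Qed.

(** The loss [d.+1] in degree [d] is compensated by the decay [4 ^- d] of the
    homogeneous parts that the larger polydisc provides. *)
Lemma partial_sum_bound L (b : nat -> R[i]) (M : R) :
  (forall theta : nat -> R, (forall j, 0 <= theta j <= 1) ->
     normc (\sum_(k < L) b k * mon (fun j => 4 * turn (theta j)) (alpha k)) <= M) ->
  forall N, normc (\sum_(k < L) if (k < N)%N then b k else 0) <= 2 * M.
Proof.
move=> bM N; pose D := (\max_(k < L) mdegree (alpha k)).+1.
have kD k : (k < L)%N -> (mdegree (alpha k) < D)%N.
  by move=> kL; rewrite ltnS (leq_bigmax (Ordinal kL)).
have small k : (k < L)%N -> (mdegree (alpha k) < 2 ^ D)%N.
  by move=> /kD kL; rewrite (ltn_trans kL)// ltn_expl.
have M0 : 0 <= M.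
  by rewrite (le_trans _ (bM (fun=> 0) _)) ?normc_ge0// => j; rewrite lexx ler01.
have bounded : roots_bounded alpha D L
    (fun k => b k * (4 : R)%:C%C ^+ mdegree (alpha k)) M.
  move=> l lr.
  have [theta th lE] : exists2 theta : nat -> R, (forall j, 0 <= theta j <= 1) &
      forall j, l j = turn (theta j).
    have [s sE] := choice lr.
    exists (fun j => (s j %% 2 ^ D)%:R / (2 ^ D)%:R) => j.
      rewrite divr_ge0//= ler_pdivrMr ?ltr0n ?expn_gt0// mul1r ler_nat.
      by rewrite ltnW// ltn_pmod// expn_gt0.
    by rewrite sE -root1_exp (prim_expr_mod (root1_prim R D)).
  apply: le_trans (bM theta th); rewrite le_eqVlt; apply/orP; left; apply/eqP.
  apply: (congr1 (@Normc.normc R)); apply: eq_bigr => k _; rewrite monM mon_const mulrA.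
  have -> : (4 : R)%:C%C = 4 by rewrite rmorph_nat.
  by congr (_ * _); apply: eq_bigr => j _; rewrite lE.
have four : 0 < 4 :> R by [].
have degree d : normc (\sum_(k < L) if (mdegree (alpha k) == d) && (k < N)%N then b k else 0)
    <= M * 2 ^- d.
  rewrite (le_trans (degree_sum_bound N small (roots_bounded_degree small d four bounded)))//.
  rewrite mulrCA ler_wpM2l// ler_pdivrMr ?exprn_gt0//.
  have -> : 4 = 2 * 2 :> R by rewrite -natrM.
  rewrite exprMn.
  rewrite mulrA mulVf ?expf_neq0// mul1r -natrX ler_nat.
  by elim: d => // d IH; rewrite expnS mul2n -addnn; lia.
have -> : \sum_(k < L) (if (k < N)%N then b k else 0) =
    \sum_(d < D) \sum_(k < L) if (mdegree (alpha k) == d) && (k < N)%N then b k else 0.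
  rewrite exchange_big /=; apply: eq_bigr => k _.
  rewrite (bigD1 (Ordinal (kD k (ltn_ord k))))//= eqxx big1 ?addr0// => d.
  by rewrite -val_eqE /= eq_sym => /negPf ->.
rewrite (le_trans (normc_sum _ _ _))//.
apply: le_trans (ler_sum _ (fun (d : 'I_D) _ => degree d)) _.
rewrite -big_distrr /= [2 * M]mulrC ler_wpM2l//.
suff : \sum_(d < D) 2 ^- d = 2 - 2 * 2 ^- D :> R.
  by move=> ->; rewrite gerBl mulr_ge0// invr_ge0 exprn_ge0.
elim: D {kD small bounded degree} => [|D IH]; first by rewrite big_ord0 expr0 invr1 mulr1 subrr.
by rewrite big_ord_recr /= IH exprS; field; rewrite expf_neq0.
Qed.

End SquareOrderPartialSums.

(** * Real-valued norms and compact sets *)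

Section RealNorm.
Variable R : realType.

(** The norm of a complex normed space takes its values in the ordered set of
    complex numbers; [rnorm] is the same norm as a real number. *)
Definition rnorm {V : normedModType R[i]} (v : V) : R := complex.Re `|v|.

Variable V : normedModType R[i].
Implicit Types u v : V.

Lemma rnormE v : `|v| = (rnorm v)%:C%C.
Proof. by rewrite /rnorm RRe_real// normr_real. Qed.

Lemma rnorm_complex (z : R[i]^o) : rnorm z = normc z.
Proof. by []. Qed.

Lemma rnorm_ge0 v : 0 <= rnorm v.
Proof. by rewrite -ler0c -rnormE. Qed.

Lemma rnormD u v : rnorm (u + v) <= rnorm u + rnorm v.
Proof. by rewrite -lecR rmorphD /= -!rnormE ler_normD. Qed.

Lemma rnormN v : rnorm (- v) = rnorm v.
Proof. by rewrite /rnorm normrN. Qed.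

Lemma rnormB u v : rnorm (u - v) <= rnorm u + rnorm v.
Proof. by have := rnormD u (- v); rewrite rnormN. Qed.

Lemma rnorm0 : rnorm (0 : V) = 0.
Proof. by rewrite /rnorm normr0. Qed.

Lemma rnormZ (a : R[i]) v : rnorm (a *: v) = normc a * rnorm v.
Proof. by apply: (@complexI R); rewrite rmorphM /= -!rnormE normrZ. Qed.

Lemma rdistC u v : rnorm (u - v) = rnorm (v - u).
Proof. by rewrite -opprB rnormN. Qed.

Lemma rnorm_eq0 v : rnorm v = 0 -> v = 0.
Proof. by move=> v0; apply/eqP; rewrite -normr_eq0 rnormE v0. Qed.

Lemma rnorm_sum I (r : seq I) (P : pred I) (F : I -> V) :
  rnorm (\sum_(i <- r | P i) F i) <= \sum_(i <- r | P i) rnorm (F i).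
Proof.
elim/big_rec2: _ => [|i y1 y2 _ h]; first by rewrite rnorm0.
by rewrite (le_trans (rnormD _ _))// lerD2l.
Qed.

Lemma real_eps (eps : R[i]) : 0 < eps -> eps = (complex.Re eps)%:C%C /\ 0 < complex.Re eps.
Proof.
move=> e0; have eE : eps = (complex.Re eps)%:C%C by rewrite RRe_real// gtr0_real.
by split => //; rewrite -ltcR -eE.
Qed.

Lemma rnorm_nbhsP v (U : set V) :
  nbhs v U <-> exists2 d : R, 0 < d & forall u, rnorm (u - v) < d -> U u.
Proof.
split=> [/nbhs_ballP[e /= e0 eU]|[d d0 dU]].
  have [eE re0] := real_eps e0; exists (complex.Re e) => // u uv.
  by apply: eU; rewrite -ball_normE /= rnormE eE ltcR rdistC.
apply/nbhs_ballP; exists d%:C%C; first by rewrite /= ltcR.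
by move=> u; rewrite -ball_normE /= rnormE ltcR rdistC => /dU.
Qed.

Lemma rnorm_cvgP (f : nat -> V) v : f @ \oo --> v <->
  forall eps : R, 0 < eps -> exists N, forall n, (N <= n)%N -> rnorm (f n - v) < eps.
Proof.
split=> [fv eps eps0|fv U /rnorm_nbhsP[e e0 eU]].
  have [|N _ HN] := fv [set u | rnorm (u - v) < eps].
    by apply/rnorm_nbhsP; exists eps.
  by exists N => n Nn; apply: HN.
by have [N HN] := fv e e0; exists N => // n /HN; exact: eU.
Qed.

End RealNorm.

Section ContinuityOnCompactSets.
Variables (R : realType) (V W : normedModType R[i]).
Implicit Types u v : V.

Lemma rnorm_continuousP (f : V -> W) v : {for v, continuous f} <->
  forall eps : R, 0 < eps -> exists2 d : R, 0 < d &
    forall u, rnorm (u - v) < d -> rnorm (f u - f v) < eps.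
Proof.
split=> [fv eps eps0|fv U /rnorm_nbhsP[e e0 eU]].
  by apply/rnorm_nbhsP; apply: (fv [set w | rnorm (w - f v) < eps]); apply/rnorm_nbhsP; exists eps.
have [d d0 dU] := fv e e0; apply/rnorm_nbhsP; exists d => // u /dU; exact: eU.
Qed.

(** Only one of the two points has to lie in the compact set: truncations and
    changes of a coordinate move points out of it. *)
Lemma compact_uniformly_continuous (f : V -> W) (A : set V) : continuous f ->
  compact A -> forall eps : R, 0 < eps -> exists2 d : R, 0 < d &
    forall a v, A a -> rnorm (v - a) < d -> rnorm (f v - f a) < eps.
Proof.
move=> cf /compact_near_coveringP cA eps eps0.
pose P (d : R) (a : V) := forall v, rnorm (v - a) < d -> rnorm (f v - f a) < eps.
have /(cA R (at_right 0) P) : forall x, A x -> \forall x' \near x & d \near at_right 0, P d x'.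
  move=> x Ax; have e20 : 0 < eps / 2 by lra.
  have [d d0 hd] := (rnorm_continuousP f x).1 (cf x) _ e20.
  exists ([set y | rnorm (y - x) < d / 2], [set e : R | e < d / 2]) => /=.
    split; first by apply/rnorm_nbhsP; exists (d / 2) => //; lra.
    by apply: nbhs_right_lt; lra.
  move=> [y e] /= [yx ed] v vy; rewrite -(subrKA (f x)).
  rewrite (le_lt_trans (rnormD _ _))// (rdistC (f x)).
  have h1 : rnorm (f y - f x) < eps / 2 by apply: hd; lra.
  have h2 : rnorm (f v - f x) < eps / 2.
    by apply: hd; rewrite -(subrKA y) (le_lt_trans (rnormD _ _))//; lra.
  lra.
move=> H; have : \forall d \near at_right (0 : R), A `<=` P d by exact: H.
move=> near_d; near (at_right (0 : R)) => d; exists d; first by near: d; exact: nbhs_right_gt.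
have AP : A `<=` P d by near: d.
by move=> a v /AP; apply.
Unshelve. all: by end_near. Qed.

Lemma compact_rnorm_bounded (f : V -> W) (A : set V) : continuous f ->
  compact A -> exists2 M : R, 0 < M & forall a, A a -> rnorm (f a) <= M.
Proof.
move=> cf /compact_near_coveringP cA.
have /(cA R (pinfty_nbhs R) (fun M x => rnorm (f x) <= M)) :
    forall x, A x -> \forall x' \near x & M \near pinfty_nbhs R, rnorm (f x') <= M.
  move=> x Ax; have [d d0 hd] := (rnorm_continuousP f x).1 (cf x) 1 ltr01.
  exists ([set y | rnorm (y - x) < d], [set M | rnorm (f x) + 1 < M]) => /=.
    split; first by apply/rnorm_nbhsP; exists d.
    by apply: nbhs_pinfty_gt; exact: num_real.
  move=> [y M] /= [/hd yx fM]; rewrite -[f y](subrK (f x)).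
  by rewrite (le_trans (rnormD _ _))//; lra.
move=> H; have {}H : \forall M \near pinfty_nbhs R, A `<=` (fun x => rnorm (f x) <= M) by exact: H.
near (pinfty_nbhs R) => M; exists M; last first.
  by have : A `<=` (fun x => rnorm (f x) <= M) by near: M.
by near: M; apply: nbhs_pinfty_gt; exact: num_real.
Unshelve. all: by end_near. Qed.

End ContinuityOnCompactSets.

(** * Solid sequence spaces *)

Section SolidSequenceSpace.
Variables (R : realType) (E : normedModType R[i]).
Variable coord : {linear E -> (nat -> R[i]^o)}.
Hypothesis coord_inj : injective coord.
Hypothesis c00_dense : dense [set v : E | finitely_supported (coord v)].
Hypothesis solid : forall (x : E) (y : nat -> R[i]),
  (forall j, `|y j| <= `|coord x j|) -> exists2 v : E, coord v = y & `|v| <= `|x|.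
Variable e : nat -> E.
Hypothesis e_unit : forall j, coord (e j) = fun k => (k == j)%:R.
Implicit Types (x v : E) (lam : nat -> R[i]).

Lemma coordD x v j : coord (x + v) j = coord x j + coord v j.
Proof. by rewrite linearD. Qed.

Lemma coordB x v j : coord (x - v) j = coord x j - coord v j.
Proof. by rewrite linearB. Qed.

Lemma coordZ (a : R[i]) v j : coord (a *: v) j = a * coord v j.
Proof. by rewrite linearZ. Qed.

Lemma coord_sum I (r : seq I) (F : I -> E) j :
  coord (\sum_(i <- r) F i) j = \sum_(i <- r) coord (F i) j.
Proof. by elim/big_rec2: _ => [|i y1 y2 _ <-]; [rewrite linear0|rewrite coordD]. Qed.

Lemma coord_ext x v : (forall j, coord x j = coord v j) -> x = v.
Proof. by move=> xv; apply: coord_inj; apply/funext. Qed.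

Lemma multiplier_exists (c : R) lam x : (forall j, normc (lam j) <= c) ->
  exists2 v, (forall j, coord v j = lam j * coord x j) & rnorm v <= c * rnorm x.
Proof.
move=> lc; have c0 : 0 <= c := le_trans (normc_ge0 _) (lc 0%N).
have [|v vE vx] := @solid (c%:C%C *: x) (fun j => lam j * coord x j).
  move=> j; rewrite coordZ !normE lecR !normc_mul normc_real ger0_norm//.
  by rewrite ler_wpM2r ?normc_ge0.
exists v; first by move=> j; rewrite vE.
by move: vx; rewrite !rnormE lecR rnormZ normc_real ger0_norm.
Qed.

(** The diagonal operator with entries [lam]; it is meaningful when [lam] is
    bounded. *)
Definition diag lam x : E := xget 0 [set v | forall j, coord v j = lam j * coord x j].

Lemma diagE (c : R) lam x : (forall j, normc (lam j) <= c) ->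
  forall j, coord (diag lam x) j = lam j * coord x j.
Proof.
move=> /multiplier_exists-/(_ x)[v vE _]; rewrite /diag.
by case: xgetP => [w _ //|] /(_ v).
Qed.

Lemma rnorm_diag (c : R) lam x : (forall j, normc (lam j) <= c) ->
  rnorm (diag lam x) <= c * rnorm x.
Proof.
move=> lc; have [v vE vx] := multiplier_exists x lc.
by rewrite (_ : diag lam x = v)//; apply: coord_ext => j; rewrite vE (diagE _ lc).
Qed.

Lemma rnorm_solid x v : (forall j, normc (coord v j) <= normc (coord x j)) ->
  rnorm v <= rnorm x.
Proof.
move=> vx; have [|w wE] := @solid x (coord v); first by move=> j; rewrite !normE lecR.
by rewrite !rnormE lecR; move/coord_inj : wE => ->.
Qed.

Lemma coord_e j k : coord (e j) k = (k == j)%:R.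
Proof. by rewrite e_unit. Qed.

Lemma rnorm_e_gt0 j : 0 < rnorm (e j).
Proof.
rewrite lt_def rnorm_ge0 andbT; apply/eqP => /rnorm_eq0 e0.
have := coord_e j j; rewrite e0 linear0 eqxx => /esym/eqP.
by rewrite oner_eq0.
Qed.

Lemma rnorm_coord_e x j : rnorm (coord x j *: e j) <= rnorm x.
Proof.
apply: rnorm_solid => k; rewrite coordZ coord_e; case: eqP => [->|_].
  by rewrite mulr1.
by rewrite mulr0 Normc.normc0 normc_ge0.
Qed.

Lemma normc_coord x j : normc (coord x j) <= (rnorm (e j))^-1 * rnorm x.
Proof.
have := rnorm_coord_e x j; rewrite rnormZ => H.
by rewrite mulrC ler_pdivlMr ?rnorm_e_gt0.
Qed.

Lemma coord_continuous j : continuous (fun x => coord x j : R[i]^o).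
Proof.
move=> x; apply/rnorm_continuousP => eps eps0.
exists (rnorm (e j) * eps) => [|u ux]; first by rewrite mulr_gt0 ?rnorm_e_gt0.
rewrite -coordB rnorm_complex (le_lt_trans (normc_coord _ _))//.
by rewrite ltr_pdivrMl ?rnorm_e_gt0.
Qed.

Definition truncate n x : E := \sum_(j < n) coord x j *: e j.

Lemma coord_truncate n x k : coord (truncate n x) k = if (k < n)%N then coord x k else 0.
Proof.
rewrite /truncate coord_sum; case: ltnP => kn.
  rewrite (bigD1 (Ordinal kn))//= coordZ coord_e eqxx mulr1 big1 ?addr0// => i.
  by rewrite -val_eqE /= coordZ coord_e eq_sym => /negPf ->; rewrite mulr0.
rewrite big1// => i _; rewrite coordZ coord_e gtn_eqF ?mulr0//.
exact: leq_trans (ltn_ord i) kn.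
Qed.

Lemma truncateB n x v : truncate n (x - v) = truncate n x - truncate n v.
Proof.
by apply: coord_ext => j; rewrite coordB !coord_truncate coordB; case: ifP; rewrite ?subr0.
Qed.

Lemma rnorm_truncate n x : rnorm (truncate n x) <= rnorm x.
Proof.
apply: rnorm_solid => j; rewrite coord_truncate; case: ifP => // _.
by rewrite Normc.normc0 normc_ge0.
Qed.

(** Truncations are contractions, so that it suffices to approximate [x] by a
    finitely supported sequence, which long truncations leave unchanged. *)
Lemma truncate_cvg x (eps : R) : 0 < eps ->
  exists N, forall n, (N <= n)%N -> rnorm (truncate n x - x) < eps.
Proof.
move=> eps0; have e20 : 0 < eps / 2 by lra.
have [v [vx fv]] : exists v, rnorm (v - x) < eps / 2 /\ finitely_supported (coord v).
  have B : nbhs x [set v | rnorm (v - x) < eps / 2] by apply/rnorm_nbhsP; exists (eps / 2).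
  have [|v [Bv fv]] := c00_dense _ (open_interior [set v | rnorm (v - x) < eps / 2]).
    by exists x; exact: B.
  by exists v; split => //; apply: (interior_subset Bv).
have [N vN] : exists N, forall j, (N <= j)%N -> coord v j = 0.
  have [N NP] : exists N, forall j, [set j | coord v j != 0] j -> (j < N)%N.
    move/finite_fsetP: fv => [F FE].
    exists (\max_(j <- F) j.+1)%N => j jF.
    have jF' : j \in F by have : [set` F] j by rewrite -FE.
    exact: (@leq_bigmax_seq _ (enum_fset F) xpredT succn j jF' isT).
  exists N => j Nj; apply/eqP; rewrite -[_ == _]negbK; apply/negP => /NP.
  by rewrite ltnNge Nj.
exists N => n Nn; have vn : truncate n v = v.
  by apply: coord_ext => j; rewrite coord_truncate; case: ltnP => // nj; rewrite vN// (leq_trans Nn).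
have -> : truncate n x - x = truncate n (x - v) - (x - v).
  by rewrite truncateB vn opprB addrA subrK.
rewrite (le_lt_trans (rnormB _ _))//.
have := rnorm_truncate n (x - v); rewrite rdistC in vx; lra.
Qed.

Lemma truncate_cvg_compact (A : set E) (eps : R) : compact A -> 0 < eps ->
  exists n, forall x, A x -> rnorm (truncate n x - x) < eps.
Proof.
move=> /compact_near_coveringP cA eps0; have e40 : 0 < eps / 4 by lra.
have /(cA nat \oo (fun n x => rnorm (truncate n x - x) < eps)) :
    forall x, A x -> \forall y \near x & n \near \oo, rnorm (truncate n y - y) < eps.
  move=> x Ax; have [N HN] := truncate_cvg x e40.
  exists ([set y | rnorm (y - x) < eps / 4], [set n | (N <= n)%N]) => /=.
    by split; [apply/rnorm_nbhsP; exists (eps / 4)|exists N].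
  move=> [y n] /= [yx Nn].
  have -> : truncate n y - y = truncate n (y - x) - (y - x) + (truncate n x - x).
    by rewrite truncateB [RHS]addrAC addrA subrK opprB addrA subrK.
  have := rnormD (truncate n (y - x) - (y - x)) (truncate n x - x).
  have := rnormB (truncate n (y - x)) (y - x); have := rnorm_truncate n (y - x).
  have := HN n Nn; lra.
move=> H; have [n _ Hn] : \forall n \near \oo, A `<=` (fun x => rnorm (truncate n x - x) < eps).
  exact: H.
by exists n => x Ax; apply: (Hn n) => //=.
Qed.

(** * The unit vectors form a 1-unconditional basis *)

Lemma partial_sum_truncate x n : series (fun k => coord x k *: e k) n = truncate n x.
Proof. by rewrite /series /= big_mkord. Qed.

Lemma coord_expansion x : series (fun k => coord x k *: e k) @ \oo --> x.
Proof.
apply/rnorm_cvgP => eps /(truncate_cvg x)[N HN]; exists N => n Nn.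
by rewrite partial_sum_truncate; exact: HN.
Qed.

Lemma expansion_coord x (a : nat -> R[i]) :
  series (fun k => a k *: e k) @ \oo --> x -> forall k, a k = coord x k.
Proof.
move=> /rnorm_cvgP ax k; apply/eqP; rewrite -subr_eq0 -normc_eq0 eq_le normc_ge0 andbT.
rewrite leNgt; apply/negP => gt0.
have [N HN] := ax _ (mulr_gt0 (rnorm_e_gt0 k) gt0).
have := HN (maxn N k.+1) (leq_maxl _ _); apply/negP; rewrite -leNgt.
have := normc_coord (series (fun k => a k *: e k) (maxn N k.+1) - x) k.
rewrite -ler_pdivrMl ?invr_gt0 ?rnorm_e_gt0// invrK; apply: le_trans.
rewrite ler_pM2l ?rnorm_e_gt0// coordB /series /= coord_sum big_mkord.
have kN : (k < maxn N k.+1)%N by rewrite leq_maxr.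
rewrite (bigD1 (Ordinal kN))//= coordZ coord_e eqxx mulr1 big1 ?addr0// => i.
by rewrite -val_eqE /= coordZ coord_e eq_sym => /negPf ->; rewrite mulr0.
Qed.

Lemma coord_coefficient_functionals :
  coefficient_functionals e (fun k x => coord x k : R[i]^o).
Proof.
split=> [k|x a]; first exact: coord_continuous.
split=> [/expansion_coord//|ak].
by rewrite (_ : a = coord x); [exact: coord_expansion|apply/funext].
Qed.

Lemma unit_vectors_unconditional : unconditional1_basis e.
Proof.
split; first by exists (fun k x => coord x k : R[i]^o); exact: coord_coefficient_functionals.
move=> x a lam /expansion_coord ax l1.
have [|y yE yx] := @solid x (fun j => lam j * coord x j).
  by move=> j; rewrite normrM ler_piMl.
exists y => //; rewrite (_ : (fun k => _) = fun k => coord y k *: e k).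
  exact: coord_expansion.
by apply/funext => k; rewrite yE ax.
Qed.

Lemma coefficient_functionals_coord (ecoef : nat -> E -> R[i]^o) :
  coefficient_functionals e ecoef -> ecoef = fun k x => coord x k.
Proof.
move=> [_ ec]; apply/funext => k; apply/funext => x.
by rewrite -(((ec x (coord x)).1 (@coord_expansion x)) k).
Qed.

(** * Compact sets that are large enough for averaging *)

(** The factor 4 is the radius at which the homogeneous parts of a polynomial gain
    the decay used in [partial_sum_bound]. *)
Definition rotate (theta : nat -> R) x : E := diag (fun j => 4 * turn (theta j)) x.

Lemma normc_4turn t : normc (4 * turn t : R[i]) = 4.
Proof. by rewrite normc_mul normc_turn normc_nat mulr1. Qed.

Lemma coord_rotate theta x j : coord (rotate theta x) j = 4 * turn (theta j) * coord x j.
Proof. by rewrite (@diagE 4)// => k; rewrite normc_4turn. Qed.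

(** Beyond [n], changing the angles costs at most a multiple of the tail of [x];
    before [n], only finitely many angles matter. This makes [rotate]
    continuous for the product topology on the angles. *)
Lemma rotate_dist n theta theta' x y : rnorm (rotate theta' y - rotate theta x) <=
  4 * rnorm (y - x) + 8 * rnorm (truncate n x - x) +
  16 * pi * rnorm x * \sum_(j < n) `|theta' j - theta j|.
Proof.
pose lam' j := 4 * turn (theta' j) : R[i]; pose del j := lam' j - 4 * turn (theta j) : R[i].
have lam'4 j : normc (lam' j) <= 4 by rewrite normc_4turn.
have del8 j : normc (del j) <= 8.
  by rewrite (le_trans (normcB_le _ _))// !normc_4turn -natrD.
pose s : E := \sum_(j < n) (del j * coord x j) *: e j.
have -> : rotate theta' y - rotate theta x = diag lam' (y - x) - diag del (truncate n x - x) + s.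
  apply: coord_ext => k; rewrite coordB !coord_rotate coordD coordB.
  rewrite (diagE _ lam'4) (diagE _ del8) !coordB coord_truncate /s coord_sum /del /lam'.
  have alg1 (a b c d : R[i]) : a * c - b * d = a * (c - d) - (a - b) * (d - d) +
      ((a - b) * d * 1 + 0) by ring.
  have alg2 (a b c d : R[i]) : a * c - b * d = a * (c - d) - (a - b) * (0 - d) + 0 by ring.
  case: ltnP => kn.
    rewrite (bigD1 (Ordinal kn))//= coordZ coord_e eqxx big1; first exact: alg1.
    by move=> i; rewrite -val_eqE /= coordZ coord_e eq_sym => /negPf ->; rewrite mulr0.
  rewrite big1; first exact: alg2.
  move=> i _; rewrite coordZ coord_e gtn_eqF ?mulr0//; exact: leq_trans (ltn_ord i) kn.
rewrite (le_trans (rnormD _ _))// lerD//.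
  rewrite (le_trans (rnormB _ _))// lerD//; exact: rnorm_diag.
rewrite (le_trans (rnorm_sum _ _ _))// big_distrr /=; apply: ler_sum => j _.
rewrite -scalerA rnormZ.
have h : normc (del j) <= 16 * pi * `|theta' j - theta j|.
  rewrite /del /lam' -mulrBr normc_mul normc_nat.
  have := turn_lipschitz (theta' j) (theta j); lra.
rewrite mulrAC ler_pM ?normc_ge0 ?rnorm_ge0//; exact: rnorm_coord_e.
Qed.

Local Notation angles := (prod_topology (fun _ : nat => R)).

Lemma nbhs_angles (theta : angles) n (d : R) : 0 < d ->
  nbhs theta [set theta' : angles | forall j, (j < n)%N -> `|theta' j - theta j| < d].
Proof.
move=> d0; elim: n => [|n IH]; first by apply: filterS filterT => th _ j.
have H : nbhs theta [set theta' : angles | `|theta' n - theta n| < d].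
  have := @proj_continuous _ (fun _ : nat => R) n theta.
  move/(_ [set t | `|t - theta n| < d]); apply.
  apply/nbhs_ballP; exists d => //= t; rewrite -ball_normE /= distrC//.
apply: filterS (filterI IH H) => th [h1 h2] j.
by rewrite ltnS leq_eqVlt => /predU1P[->//|/h1].
Qed.

Lemma rotate_continuous : continuous (fun p : angles * E => rotate p.1 p.2).
Proof.
move=> [theta x] /= U /rnorm_nbhsP[eps eps0 epsU].
have e24 : 0 < eps / 24 by lra.
have [n Hn] := truncate_cvg x e24.
pose c := 16 * pi * (rnorm x + 1) * n.+1%:R; pose d := eps / (4 * c).
have pi0 : 0 < pi :> R := pi_gt0 R.
have c0 : 0 < c.
  by rewrite !mulr_gt0 ?ltr0n// ltr_wpDl ?rnorm_ge0.
have d0 : 0 < d by rewrite divr_gt0// mulr_gt0.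
exists ([set th : angles | forall j, (j < n)%N -> `|th j - theta j| < d],
        [set y | rnorm (y - x) < eps / 24]) => /=.
  by split; [exact: nbhs_angles|apply/rnorm_nbhsP; exists (eps / 24)].
move=> [th y] /= [thP yx]; apply: epsU.
rewrite (le_lt_trans (rotate_dist n _ _ _ _))//.
have h3 : 16 * pi * rnorm x * \sum_(j < n) `|th j - theta j| <= eps / 4.
  have -> : eps / 4 = c * d by rewrite /d; field; rewrite gt_eqF.
  rewrite /c -[leRHS]mulrA ler_pM ?sumr_ge0 ?mulr_ge0 ?rnorm_ge0 ?(ltW pi0)//.
    by rewrite ler_wpM2l ?mulr_ge0 ?(ltW pi0)// lerDl.
  apply: le_trans (_ : n%:R * d <= _).
    rewrite (le_trans (_ : _ <= \sum_(j < n) d))//; last by rewrite sumr_const card_ord mulr_natl.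
    by apply: ler_sum => j _; rewrite ltW ?thP.
  by rewrite ler_wpM2r ?(ltW d0)// ler_nat.
have := Hn n (leqnn n); lra.
Qed.

Definition hull (A : set E) : set E :=
  [set y | exists2 theta : nat -> R, (forall j, 0 <= theta j <= 1) &
           exists2 x, A x & y = rotate theta x].

Lemma hull_compact A : compact A -> compact (hull A).
Proof.
move=> cA; have cT : compact [set theta : angles | forall j, `[0, 1]%classic (theta j)].
  by apply: (@tychonoff _ (fun _ : nat => R) (fun _ => `[0, 1]%classic)) => j; exact: segment_compact.
have -> : hull A = (fun p : angles * E => rotate p.1 p.2) @`
    ([set theta : angles | forall j, `[0, 1]%classic (theta j)] `*` A).
  apply/seteqP; split=> [_ [theta th [x Ax ->]]|_ [[theta x] /= [th Ax] <-]].
    by exists (theta, x) => //; split => //= j; rewrite in_itv /= th.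
  by exists theta; [move=> j; have := th j; rewrite /= in_itv|exists x].
apply: continuous_compact; last exact: compact_setX.
apply: continuous_subspaceT; exact: rotate_continuous.
Qed.

(** * Polynomials are dense *)

(** Continuity and holomorphy on complex lines; these survive fixing a coordinate
    and composing with a truncation, and are all that the discrete Cauchy
    formula needs. *)
Definition gentire (f : E -> R[i]) := continuous (f : E -> R[i]^o) /\
  forall x v (z : R[i]^o), derivable (fun t : R[i]^o => f (x + t *: v) : R[i]^o) z 1.

Lemma entire_gentire (f : entire E) : gentire f.
Proof.
split=> [x|x v z]; first exact/differentiable_continuous/holomorphic_entire.
apply/derivable1_diffP; apply: (@differentiable_comp _ _ _ _ (fun t : R[i]^o => x + t *: v) f).
  apply: differentiableD; first exact: differentiable_cst.
  exact: ex_diff.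
exact: holomorphic_entire.
Qed.

Lemma gentire_sum n (a : 'I_n -> R[i]) (f : 'I_n -> E -> R[i]) :
  (forall l, gentire (f l)) -> gentire (fun x => \sum_(l < n) a l * f l x).
Proof.
move=> gf; split=> [x|x v z].
  apply: (@cvg_big R[i]^o) => [|l _]; first exact: add_continuous.
  by apply: cvgM; [exact: cvg_cst|exact: (gf l).1].
rewrite (_ : (fun t => _) = \sum_(l < n) (fun t : R[i]^o => a l * f l (x + t *: v) : R[i]^o)); last first.
  by apply/funext => t; rewrite fct_sumE.
apply: derivable_sum => l; apply: derivableM; first exact: derivable_cst.
exact: (gf l).2.
Qed.

Definition put i (c : R[i]) x : E := x + (c - coord x i) *: e i.

Lemma coord_put i c x k : coord (put i c x) k = if k == i then c else coord x k.
Proof.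
by rewrite coordD coordZ coord_e; case: eqP => [->|_]; rewrite ?mulr1 ?mulr0 ?addr0 ?subrKC.
Qed.

Lemma put_id i x : put i (coord x i) x = x.
Proof. by rewrite /put subrr scale0r addr0. Qed.

Lemma put_line i c x v t : put i c (x + t *: v) = put i c x + t *: (v - coord v i *: e i).
Proof.
apply: coord_ext => k; rewrite coordD coordZ coordB coordZ !coord_put coord_e coordD coordZ.
by case: eqP => [->|_]; rewrite ?mulr1 ?subrr ?mulr0 ?addr0 ?subr0.
Qed.

Lemma put_dist i c c' x x' :
  rnorm (put i c x - put i c' x') <= 2 * rnorm (x - x') + rnorm (e i) * normc (c - c').
Proof.
have -> : put i c x - put i c' x' = (x - x') - coord (x - x') i *: e i + (c - c') *: e i.
  apply: coord_ext => k; rewrite [LHS]coordB !coord_put [RHS]coordD !coordB !coordZ coord_e.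
  by case: eqP => [->|_]; rewrite ?mulr1 ?subrr ?add0r// !mulr0 subr0 addr0.
rewrite (le_trans (rnormD _ _))// lerD//; last by rewrite rnormZ mulrC.
by rewrite (le_trans (rnormB _ _))// mulr2n mulrDl !mul1r lerD2l rnorm_coord_e.
Qed.

Lemma put_continuous i c : continuous (put i c).
Proof.
move=> x; apply/rnorm_continuousP => eps eps0; exists (eps / 2); first by lra.
move=> u ux; rewrite (le_lt_trans (put_dist _ _ _ _ _))//.
rewrite subrr Normc.normc0 mulr0 addr0; lra.
Qed.

Lemma gentire_put f i c : gentire f -> gentire (fun x => f (put i c x)).
Proof.
move=> [cf df]; split=> [x|x v z].
  exact: (@continuous_comp E E R[i]^o (put i c) f x (put_continuous (x := x)) (cf _)).
rewrite (_ : (fun t => _) = fun t : R[i]^o => f (put i c x + t *: (v - coord v i *: e i)) : R[i]^o).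
  exact: df.
by apply/funext => t; rewrite put_line.
Qed.

Definition coord_mean (f : E -> R[i]) i (r : R) m x :=
  cauchy_mean (fun w => f (put i w x)) r m (coord x i).

Lemma coord_mean_cvg f i r x : gentire f -> normc (coord x i) < r ->
  forall eps, 0 < eps -> exists M, forall m, (M <= m)%N ->
  normc (coord_mean f i r m x - f x) < eps.
Proof.
move=> [_ df] xr eps eps0; rewrite -{2}(put_id i x).
apply: (@cauchy_mean_cvg _ (fun w : R[i]^o => f (put i w x) : R[i]^o)) => // w.
rewrite (_ : (fun w => _) = fun t : R[i]^o => f (x - coord x i *: e i + t *: e i) : R[i]^o).
  exact: df.
by apply/funext => t; rewrite /put scalerBl addrA addrAC.
Qed.

Lemma coord_mean_dist f i (r : R) m x y (eta B : R) : 0 < r ->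
  normc (coord x i) <= r / 2 -> normc (coord y i) <= r / 2 ->
  (forall t, 0 <= t <= 1 ->
     normc (f (put i (r%:C%C * turn t) y) - f (put i (r%:C%C * turn t) x)) <= eta) ->
  (forall t, 0 <= t <= 1 -> normc (f (put i (r%:C%C * turn t) x)) <= B) ->
  normc (coord_mean f i r m y - coord_mean f i r m x) <=
  2 * eta + B * (4 * (normc (coord y i - coord x i) / r)).
Proof.
move=> r0 xr yr hd hB; rewrite /coord_mean /cauchy_mean -mulrBr -sumrB.
set N := (2 ^ m)%N; have N0 : 0 < N%:R :> R by rewrite ltr0n expn_gt0.
rewrite normc_mul normc_inv normc_nat ler_pdivrMl// (le_trans (normc_sum _ _ _))//.
set C := 2 * eta + _; rewrite (le_trans (_ : _ <= \sum_(l < N) C))//; last first.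
  by rewrite sumr_const card_ord mulr_natl.
apply: ler_sum => l _; set zeta := r%:C%C * _.
have nz : normc zeta = r by rewrite normc_mul normc_root1_exp normc_real mulr1 gtr0_norm.
have [t t01 zE] : exists2 t : R, 0 <= t <= 1 & zeta = r%:C%C * turn t.
  exists (l%:R / N%:R); last by rewrite -root1_exp.
  by rewrite divr_ge0//= ler_pdivrMr// mul1r ler_nat ltnW.
move: (hd t t01) (hB t t01); rewrite -zE.
move: (f _) (f _) => fx fy hfd hfB.
have half w : normc w <= r / 2 -> normc (w / zeta) <= 2^-1.
  by move=> wr; rewrite normc_mul normc_inv nz ler_pdivrMr// mulrC.
have -> : fy * gsum N (coord y i / zeta) - fx * gsum N (coord x i / zeta) =
  (fy - fx) * gsum N (coord y i / zeta) +
  fx * (gsum N (coord y i / zeta) - gsum N (coord x i / zeta)) by ring.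
rewrite (le_trans (normcD_le _ _))// !normc_mul /C lerD//.
  by rewrite mulrC ler_pM ?normc_ge0// gsum_bound// half.
rewrite ler_pM ?normc_ge0// (le_trans (gsum_lipschitz _ (half _ yr) (half _ xr)))//.
by rewrite -mulrBl normc_mul normc_inv nz.
Qed.

Lemma put_circle_compact i (r : R) (A : set E) : compact A ->
  compact [set y | exists2 t : R, 0 <= t <= 1 & exists2 x, A x & y = put i (r%:C%C * turn t) x].
Proof.
move=> cA; set B := [set y | _].
have -> : B = (fun p : R * E => put i (r%:C%C * turn p.1) p.2) @` (`[0, 1]%classic `*` A).
  apply/seteqP; split=> [_ [t t01 [x Ax ->]]|_ [[t x] /= [t01 Ax] <-]].
    by exists (t, x) => //=; split; rewrite //= in_itv.
  by exists t; [rewrite in_itv in t01|exists x].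
apply: continuous_compact; last by apply: compact_setX => //; exact: segment_compact.
apply: continuous_subspaceT => -[t x] U /= /rnorm_nbhsP[eps eps0 epsU].
pose c := rnorm (e i) * (`|r| * (4 * pi)) + 1.
have pi0 : 0 <= pi :> R := pi_ge0 R.
have c0 : 0 < c by rewrite ltr_wpDl// mulr_ge0 ?rnorm_ge0// !mulr_ge0.
exists ([set s : R | `|s - t| < eps / (2 * c)], [set y | rnorm (y - x) < eps / 4]) => /=.
  split; last by apply/rnorm_nbhsP; exists (eps / 4) => //; lra.
  apply/nbhs_ballP; exists (eps / (2 * c)) => /=; first by rewrite divr_gt0// mulr_gt0.
  by move=> s; rewrite -ball_normE /= distrC.
move=> [s y] /= [st yx]; apply: epsU; rewrite (le_lt_trans (put_dist _ _ _ _ _))//.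
rewrite -mulrBr normc_mul normc_real.
have h : rnorm (e i) * (`|r| * normc (turn s - turn t)) <= c * `|s - t|.
  apply: le_trans (_ : rnorm (e i) * (`|r| * (4 * pi * `|s - t|)) <= _).
    by rewrite ler_wpM2l ?rnorm_ge0// ler_wpM2l// turn_lipschitz.
  by rewrite /c !mulrA mulrDl lerDl mulr_ge0.
have : c * `|s - t| < eps / 2.
  have -> : eps / 2 = c * (eps / (2 * c)) by field; rewrite gt_eqF.
  by rewrite ltr_pM2l.
lra.
Qed.

(** Pointwise convergence upgrades to uniform convergence on compact sets
    because the means are equicontinuous. *)
Lemma coord_mean_cvg_compact f i (r : R) (A : set E) (eps : R) : gentire f ->
  compact A -> 0 < r -> (forall x, A x -> normc (coord x i) <= r / 2) -> 0 < eps ->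
  exists m, forall x, A x -> normc (coord_mean f i r m x - f x) < eps.
Proof.
move=> gf cA r0 Ar eps0; have [cf _] := gf.
set A' := [set y | exists2 t : R, 0 <= t <= 1 & exists2 x, A x & y = put i (r%:C%C * turn t) x].
have cA' : compact A' := @put_circle_compact i r A cA.
have [B B0 HB] := compact_rnorm_bounded cf cA'.
have e8 : 0 < eps / 8 by lra.
have [d d0 Hd] := compact_uniformly_continuous cf cA' e8.
have := (near_covering_withinP A).2 ((compact_near_coveringP A).1 cA).
move/(_ nat \oo (fun m x => normc (coord_mean f i r m x - f x) < eps)).
case=> [x Ax|m _ Hm]; last by exists m => x Ax; exact: (Hm m (leqnn m)).
have e4 : 0 < eps / 4 by lra.
have [|M HM] := @coord_mean_cvg f i r x gf _ _ e4.
  by rewrite (le_lt_trans (Ar x Ax))//; lra.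
have [d1 d10 Hd1] := (rnorm_continuousP (W := R[i]^o) f x).1 (cf x) _ e4.
pose c := B * 4 * (rnorm (e i))^-1 / r.
have c0 : 0 < c by rewrite divr_gt0// mulr_gt0 ?invr_gt0 ?rnorm_e_gt0// mulr_gt0.
(* The three bounds serve the movement of the circle of nodes, of [f] itself, and
   of the kernel, in this order. *)
pose d2 := Num.min (d / 2) (Num.min d1 (eps / (4 * c))).
have d20 : 0 < d2 by rewrite !lt_min d10 !divr_gt0// mulr_gt0.
exists ([set y | rnorm (y - x) < d2], [set m | (M <= m)%N]) => /=.
  by split; [apply/rnorm_nbhsP; exists d2|exists M].
move=> [y m] /= [yx Mm] Ay.
move: yx; rewrite !lt_min => /and3P[yd yd1 yc].
have h1 : normc (coord_mean f i r m y - coord_mean f i r m x) <=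
    2 * (eps / 8) + B * (4 * (normc (coord y i - coord x i) / r)).
  apply: coord_mean_dist => //; [exact: Ar|exact: Ar| |].
    move=> t t01; apply/ltW/(Hd _ _); first by exists t => //; exists x.
    by rewrite (le_lt_trans (put_dist _ _ _ _ _))// subrr Normc.normc0 mulr0 addr0; lra.
  by move=> t t01; apply: HB; exists t => //; exists x.
have h2 : B * (4 * (normc (coord y i - coord x i) / r)) < eps / 4.
  have hc : normc (coord y i - coord x i) <= (rnorm (e i))^-1 * rnorm (y - x).
    by rewrite -coordB normc_coord.
  apply: le_lt_trans (_ : c * rnorm (y - x) < _).
    have -> : c * rnorm (y - x) = B * (4 * ((rnorm (e i))^-1 * rnorm (y - x) / r)).
      by rewrite /c; field; rewrite !gt_eqF ?rnorm_e_gt0.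
    by rewrite ler_wpM2l ?(ltW B0)// ler_wpM2l// ler_wpM2r// invr_ge0 ltW.
  have -> : eps / 4 = c * (eps / (4 * c)) by field; rewrite gt_eqF.
  by rewrite ltr_pM2l.
have h3 := HM m Mm; have h4 : normc (f y - f x) < eps / 4 := Hd1 y yd1.
have -> : coord_mean f i r m y - f y = coord_mean f i r m y - coord_mean f i r m x +
  (coord_mean f i r m x - f x) - (f y - f x) by ring.
have := normcB_le (coord_mean f i r m y - coord_mean f i r m x +
  (coord_mean f i r m x - f x)) (f y - f x).
have := normcD_le (coord_mean f i r m y - coord_mean f i r m x)
  (coord_mean f i r m x - f x).
lra.
Qed.

Definition mean_coef (f : E -> R[i]) i (r : R) m j x : R[i] :=
  \sum_(l < 2 ^ m) ((2 ^ m)%:R^-1 * (r%:C%C * root1 R m ^+ l) ^- j) *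
                   f (put i (r%:C%C * root1 R m ^+ l) x).

Lemma coord_meanE f i (r : R) m x :
  coord_mean f i r m x = \sum_(j < 2 ^ m) coord x i ^+ j * mean_coef f i r m j x.
Proof.
rewrite /coord_mean /cauchy_mean /mean_coef /gsum.
under [RHS]eq_bigr do rewrite big_distrr /=.
rewrite [RHS]exchange_big /= big_distrr /=; apply: eq_bigr => l _.
rewrite !big_distrr /=; apply: eq_bigr => j _.
rewrite exprMn exprVn; move: (coord x i ^+ j) (f _) (_ ^- j) (_^-1) => a b c d; ring.
Qed.

Lemma gentire_mean_coef f i (r : R) m j : gentire f -> gentire (mean_coef f i r m j).
Proof. by move=> gf; apply: gentire_sum => l; exact: gentire_put. Qed.

Variable alpha : nat -> multiindex.
Hypothesis calpha : compatible alpha.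

Definition spanned (p : E -> R[i]) := exists L (a : nat -> R[i]),
  forall x, p x = \sum_(k < L) a k * mon (coord x) (alpha k).

Lemma spanned_eq p q : (forall x, p x = q x) -> spanned p -> spanned q.
Proof. by move=> pq [L [a pE]]; exists L, a => x; rewrite -pq. Qed.

Lemma spanned_pad p : spanned p -> exists L, forall L', (L <= L')%N ->
  exists a : nat -> R[i], forall x, p x = \sum_(k < L') a k * mon (coord x) (alpha k).
Proof.
move=> [L [a pE]]; exists L => L' LL'.
exists (fun k => if (k < L)%N then a k else 0) => x; rewrite pE.
rewrite (big_ord_widen L' (fun k => a k * mon (coord x) (alpha k)) LL') big_mkcond /=.
by apply: eq_bigr => k _; case: ifP; rewrite ?mul0r.
Qed.

Lemma spannedD p q : spanned p -> spanned q -> spanned (fun x => p x + q x).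
Proof.
move=> /spanned_pad[L hL] /spanned_pad[L' hL'].
have [a aE] := hL _ (leq_maxl L L'); have [b bE] := hL' _ (leq_maxr L L').
exists (maxn L L'), (fun k => a k + b k) => x; rewrite aE bE -big_split /=.
by apply: eq_bigr => k _; rewrite mulrDl.
Qed.

Lemma spanned_sum n (p : 'I_n -> E -> R[i]) : (forall j, spanned (p j)) ->
  spanned (fun x => \sum_(j < n) p j x).
Proof.
elim: n p => [|n IH] p sp.
  by exists 0%N, (fun=> 0) => x; rewrite !big_ord0.
apply: (@spanned_eq (fun x => \sum_(j < n) p (widen_ord (leqnSn n) j) x + p ord_max x)).
  by move=> x; rewrite big_ord_recr.
by apply: spannedD => //; apply: IH.
Qed.

Lemma spanned_mon (c : R[i]) a : spanned (fun x => c * mon (coord x) a).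
Proof.
have [beta _ bK] := calpha.1; set k0 := beta a.
exists k0.+1, (fun k => if k == k0 then c else 0) => x.
rewrite big_ord_recr /= eqxx bK big1 ?add0r// => k _.
by rewrite ltn_eqF// mul0r.
Qed.

Lemma spanned_coord i p : spanned p -> spanned (fun x => coord x i * p x).
Proof.
move=> [L [a pE]].
apply: (@spanned_eq (fun x => \sum_(k < L) a k * mon (coord x) (mshift i (alpha k)))).
  by move=> x; rewrite pE big_distrr /=; apply: eq_bigr => k _; rewrite mon_shift mulrCA.
by apply: spanned_sum => k; exact: spanned_mon.
Qed.

Lemma spanned_coordX i n p : spanned p -> spanned (fun x => coord x i ^+ n * p x).
Proof.
elim: n => [|n IH] sp; first by apply: spanned_eq sp => x; rewrite expr0 mul1r.
by apply: (spanned_eq _ (spanned_coord i (IH sp))) => x; rewrite exprS mulrA.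
Qed.

(** A function of finitely many coordinates is approximated by replacing its
    coordinates one at a time by their polynomial means; the coefficients of
    the resulting polynomial depend on one coordinate less. *)
Lemma spanned_dense_coords n d i f (A : set E) (eps : R) : (i + d = n)%N -> gentire f ->
  (forall x y, (forall j, (i <= j < n)%N -> coord x j = coord y j) -> f x = f y) ->
  compact A -> 0 < eps -> exists2 p, spanned p & forall x, A x -> normc (f x - p x) < eps.
Proof.
elim: d i f eps => [|d IH] i f eps idn gf fdep cA eps0.
  exists (fun x => f 0 * mon (coord x) mzero); first exact: spanned_mon.
  move=> x _; rewrite mon0 mulr1 (fdep x 0) ?subrr ?Normc.normc0// => j.
  by move: idn; rewrite addn0 => -> /andP[]; rewrite leqNgt => /negP.
have [M M0 HM] := compact_rnorm_bounded (W := R[i]^o) (@coord_continuous i) cA.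
have r0 : 0 < 2 * M by rewrite mulr_gt0.
have e20 : 0 < eps / 2 by lra.
have Ar x : A x -> normc (coord x i) <= 2 * M / 2.
  by move=> /HM; rewrite [2 * M]mulrC mulfK.
have [m Hm] := coord_mean_cvg_compact gf cA r0 Ar e20.
pose N := (2 ^ m)%N.
have N0 : 0 < N%:R :> R by rewrite ltr0n expn_gt0.
(* On [A] the [j]-th coefficient is multiplied by at most [M ^+ j], and there are
   [N] of them. *)
pose epsj j := eps / (2 * N%:R * M ^+ j).
have epsj0 j : 0 < epsj j by rewrite divr_gt0// mulr_gt0 ?exprn_gt0// mulr_gt0.
have exq j : exists q, spanned q /\ forall x, A x ->
    normc (mean_coef f i (2 * M) m j x - q x) < epsj j.
  have [|||||q sq qE] := IH i.+1 (mean_coef f i (2 * M) m j) (epsj j).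
  - by rewrite addSnnS.
  - exact: gentire_mean_coef.
  - move=> x y xy; apply: eq_bigr => l _; congr (_ * _); apply: fdep => k /andP[ik kn].
    rewrite !coord_put; case: eqP => // /eqP ki; apply: xy.
    by rewrite kn ltn_neqAle eq_sym ki ik.
  - exact: cA.
  - exact: epsj0.
  - by exists q.
have [q qP] := choice exq.
exists (fun x => \sum_(j < N) coord x i ^+ j * q j x).
  by apply: spanned_sum => j; apply: spanned_coordX; exact: (qP j).1.
move=> x Ax.
rewrite -(subrKA (coord_mean f i (2 * M) m x)) (le_lt_trans (normcD_le _ _))//.
have h1 : normc (f x - coord_mean f i (2 * M) m x) < eps / 2.
  by rewrite -normc_opp opprB Hm.
suff h2 : normc (coord_mean f i (2 * M) m x - \sum_(j < N) coord x i ^+ j * q j x) <= eps / 2.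
  lra.
rewrite coord_meanE -sumrB (le_trans (normc_sum _ _ _))//.
rewrite (le_trans (_ : _ <= \sum_(j < N) eps / (2 * N%:R)))//; last first.
  rewrite sumr_const card_ord -mulr_natl le_eqVlt; apply/orP; left; apply/eqP.
  by field; rewrite gt_eqF.
apply: ler_sum => j _; rewrite -mulrBr normc_mul normc_exp.
have -> : eps / (2 * N%:R) = M ^+ j * epsj j.
  rewrite /epsj; have Mj : M ^+ j != 0 by rewrite expf_neq0 ?gt_eqF.
  by move: (M ^+ j) Mj => Mj Mj0; field; rewrite Mj0 gt_eqF.
rewrite ler_pM ?normc_ge0 ?exprn_ge0 ?normc_ge0//; last by rewrite ltW// (qP j).2.
by rewrite lerXn2r ?nnegrE ?normc_ge0 ?(ltW M0)// -rnorm_complex HM.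
Qed.

Lemma spanned_dense f (A : set E) (eps : R) : gentire f -> compact A -> 0 < eps ->
  exists2 p, spanned p & forall x, A x -> normc (f x - p x) < eps.
Proof.
move=> gf cA eps0; have [cf df] := gf; have e20 : 0 < eps / 2 by lra.
have [d d0 Hd] := compact_uniformly_continuous (W := R[i]^o) cf cA e20.
have [n Hn] := truncate_cvg_compact cA d0.
have truncD x v t : truncate n (x + t *: v) = truncate n x + t *: truncate n v.
  by apply: coord_ext => j; rewrite coordD coordZ !coord_truncate coordD coordZ;
     case: ifP; rewrite ?mulr0 ?addr0.
have ct : continuous (truncate n).
  move=> x; apply/rnorm_continuousP => ep ep0; exists ep => // u ux.
  by rewrite -truncateB (le_lt_trans (rnorm_truncate _ _)).
have gg : gentire (fun x => f (truncate n x)).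
  split=> [x|x v z].
    exact: (@continuous_comp E E R[i]^o (truncate n) f x (ct _) (cf _)).
  rewrite (_ : (fun t => _) =
    fun t : R[i]^o => f (truncate n x + t *: truncate n v) : R[i]^o); first exact: df.
  by apply/funext => t; rewrite truncD.
have [|||p sp pE] := @spanned_dense_coords n n 0 _ A (eps / 2) (add0n n) gg.
- move=> x y xy; congr f; apply: coord_ext => j; rewrite !coord_truncate.
  by case: ifP => // jn; apply: xy.
- exact: cA.
- exact: e20.
exists p => // x Ax; rewrite -(subrKA (f (truncate n x))) (le_lt_trans (normcD_le _ _))//.
have h := pE x Ax.
have : normc (f x - f (truncate n x)) < eps / 2.
  by rewrite -normc_opp opprB; apply: (Hd x) => //; exact: Hn.
lra.
Qed.

(** * Coefficient functionals *)

(** The coefficients form an infinite sequence that vanishes from some index on,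
    so that expansions of different lengths can be subtracted. *)
Definition expands (a : nat -> R[i]) (p : E -> R[i]) := exists2 L,
  forall k, (L <= k)%N -> a k = 0 &
  forall x, p x = \sum_(k < L) a k * mon (coord x) (alpha k).

Lemma expands_large a p : expands a p -> exists L, forall L', (L <= L')%N ->
  (forall k, (L' <= k)%N -> a k = 0) /\
  forall x, p x = \sum_(k < L') a k * mon (coord x) (alpha k).
Proof.
move=> [L a0 pE]; exists L => L' LL'; split=> [k /(leq_trans LL')/a0//|x].
rewrite pE; apply: (@sum_zero_tail _ (fun k => a k * mon (coord x) (alpha k)) _ _ LL') => k.
by move=> /a0 ->; rewrite mul0r.
Qed.

Lemma spanned_expands p : spanned p -> exists a, expands a p.
Proof.
move=> [L [a pE]]; exists (fun k => if (k < L)%N then a k else 0), L.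
  by move=> k; rewrite ltnNge => ->.
by move=> x; rewrite pE; apply: eq_bigr => k _; rewrite ltn_ord.
Qed.

Lemma expandsB a b p q : expands a p -> expands b q ->
  expands (fun k => a k - b k) (fun x => p x - q x).
Proof.
move=> /expands_large[L hL] /expands_large[L' hL'].
have [a0 pE] := hL _ (leq_maxl L L'); have [b0 qE] := hL' _ (leq_maxr L L').
exists (maxn L L') => [k kL|x]; first by rewrite a0// b0// subrr.
by rewrite pE qE -sumrB; apply: eq_bigr => k _; rewrite mulrBl.
Qed.

(** The terms of [p] at a rotation of [x] are those at [x] times monomials in the
    rotation, so that [partial_sum_bound] applies to the terms at [x]. *)
Lemma expands_partial_bound a p x (M : R) : expands a p ->
  (forall y, hull [set x] y -> normc (p y) <= M) ->
  forall N, normc (\sum_(k < N) a k * mon (coord x) (alpha k)) <= 2 * M.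
Proof.
move=> /expands_large[L0 hL] pM N; set L := maxn L0 N.
have [_ pE] := hL L (leq_maxl _ _); have NL : (N <= L)%N by rewrite leq_maxr.
rewrite (big_ord_widen L (fun k => a k * mon (coord x) (alpha k)) NL) big_mkcond /=.
apply: (@partial_sum_bound _ _ calpha L (fun k => a k * mon (coord x) (alpha k))).
move=> theta th.
rewrite (eq_bigr (fun k : 'I_L => a k * mon (coord (rotate theta x)) (alpha k))).
  by rewrite -pE; apply: pM; exists theta => //; exists x.
move=> k _; rewrite -mulrA -monM; congr (_ * _); apply: eq_bigr => j _.
by rewrite coord_rotate mulrC.
Qed.

(** At this point the [k]-th term of an expansion equals its coefficient, so that
    bounds for terms become bounds for coefficients. *)
Definition unit_point k : E := \sum_(j < mlen (alpha k)) e j.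

Lemma mon_unit_point k : mon (coord (unit_point k)) (alpha k) = 1.
Proof.
rewrite (monE _ (leqnn _)) big1// => j _; rewrite /unit_point coord_sum.
rewrite (bigD1 j)//= coord_e eqxx big1 ?addr0 ?expr1n// => i.
by rewrite -val_eqE /= coord_e eq_sym => /negPf ->.
Qed.

Definition coef_set k : set E := hull [set unit_point k].

Lemma coef_set_compact k : compact (coef_set k).
Proof. exact: (@hull_compact [set unit_point k] (@compact_set1 _ _)). Qed.

Lemma expands_coef_bound a p k (M : R) : expands a p ->
  (forall y, coef_set k y -> normc (p y) <= M) -> normc (a k) <= 4 * M.
Proof.
move=> ap pM; have H := expands_partial_bound ap pM.
have -> : a k = \sum_(l < k.+1) a l * mon (coord (unit_point k)) (alpha l) -
                \sum_(l < k) a l * mon (coord (unit_point k)) (alpha l).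
  by rewrite big_ord_recr /= mon_unit_point mulr1 addrAC subrr add0r.
by have := H k; have := H k.+1; have := normcB_le
  (\sum_(l < k.+1) a l * mon (coord (unit_point k)) (alpha l))
  (\sum_(l < k) a l * mon (coord (unit_point k)) (alpha l)); lra.
Qed.

(** Each polynomial approximating [f] confines the real and the imaginary part of
    the coefficient to an interval proportional to the error. By
    [expands_coef_bound] these intervals meet pairwise, hence have a common
    point. *)
Lemma coef_exists k (f : E -> R[i]) : gentire f -> exists c : R[i],
  forall a p (M : R), expands a p ->
    (forall y, coef_set k y -> normc (f y - p y) <= M) -> normc (c - a k) <= 8 * M.
Proof.
move=> gf; pose I := ((nat -> R[i]) * (E -> R[i]) * R)%type.
pose P (t : I) := expands t.1.1 t.1.2 /\
  forall y, coef_set k y -> normc (f y - t.1.2 y) <= t.2.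
have exP : exists t, P t.
  have [p sp pE] := spanned_dense gf (@coef_set_compact k) ltr01.
  have [a ap] := spanned_expands sp.
  by exists ((a, p), 1); split => // y /pE/ltW.
have close s t : P s -> P t -> normc (s.1.1 k - t.1.1 k) <= 4 * (s.2 + t.2).
  move=> [es hs] [et ht]; apply: (expands_coef_bound (expandsB es et)) => y ky.
  have -> : s.1.2 y - t.1.2 y = (f y - t.1.2 y) - (f y - s.1.2 y) by ring.
  by rewrite (le_trans (normcB_le _ _))// addrC lerD ?hs ?ht.
have [u uP] : exists u : R, forall t, P t ->
    complex.Re (t.1.1 k) - 4 * t.2 <= u <= complex.Re (t.1.1 k) + 4 * t.2.
  apply: separating_point => // s t Ps Pt; have := close s t Ps Pt.
  have := Re_le_normc (s.1.1 k - t.1.1 k); rewrite ReB ler_norml; lra.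
have [v vP] : exists v : R, forall t, P t ->
    complex.Im (t.1.1 k) - 4 * t.2 <= v <= complex.Im (t.1.1 k) + 4 * t.2.
  apply: separating_point => // s t Ps Pt; have := close s t Ps Pt.
  have := Im_le_normc (s.1.1 k - t.1.1 k); rewrite ImB ler_norml; lra.
exists (u +i* v)%C => a p M ap pM.
have Pt : P ((a, p), M) by split.
have := uP _ Pt; have := vP _ Pt => /= hv hu.
rewrite (le_trans (normc_le_ReIm _))// ReB ImB /=.
have h1 : `|u - complex.Re (a k)| <= 4 * M by rewrite ler_norml; lra.
have h2 : `|v - complex.Im (a k)| <= 4 * M by rewrite ler_norml; lra.
lra.
Qed.

Lemma coef_sets_compact n : compact [set y | exists2 k, (k < n)%N & coef_set k y].
Proof.
elim: n => [|n IH].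
  rewrite (_ : [set y | _] = set0); first exact: compact0.
  by apply/seteqP; split => // y [].
rewrite (_ : [set y | _] =
  [set y | exists2 k, (k < n)%N & coef_set k y] `|` coef_set n).
  by apply: compactU; [exact: IH|exact: coef_set_compact].
apply/seteqP; split=> y /=.
  move=> [k]; rewrite ltnS leq_eqVlt => /predU1P[->|kn] ky; first by right.
  by left; exists k.
by case=> [[k kn ky]|ny]; [exists k => //; rewrite ltnS ltnW|exists n].
Qed.

Lemma hull_mono (A B : set E) : A `<=` B -> hull A `<=` hull B.
Proof. by move=> AB _ [th tP [x /AB Bx ->]]; exists th => //; exists x. Qed.

(** Long partial sums reproduce a polynomial [p] close to [f], and the partial sums
    of [f] and [p] stay close by equicontinuity. *)
Lemma expansion_converges (f : E -> R[i]) (c : nat -> R[i]) (A : set E) (eps : R) :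
  gentire f ->
  (forall k a p (M : R), expands a p ->
    (forall y, coef_set k y -> normc (f y - p y) <= M) -> normc (c k - a k) <= 8 * M) ->
  compact A -> 0 < eps -> exists N, forall n, (N <= n)%N -> forall x, A x ->
    normc (f x - \sum_(k < n) c k * mon (coord x) (alpha k)) < eps.
Proof.
move=> gf cP cA eps0; have e4 : 0 < eps / 4 by lra.
have cHA : compact (hull A `|` A) by apply: compactU => //; exact: hull_compact.
have [p /spanned_expands[a ap] pE] := spanned_dense gf cHA e4.
have [L hL] := expands_large ap; exists L => n Ln x Ax; have [_ pS] := hL n Ln.
have -> : f x - \sum_(k < n) c k * mon (coord x) (alpha k) =
    (f x - p x) - \sum_(k < n) (c k - a k) * mon (coord x) (alpha k).
  under [in RHS]eq_bigr do rewrite mulrBl.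
  by rewrite sumrB -pS opprB addrA subrK.
have h1 : normc (f x - p x) < eps / 4 by apply: pE; right.
suff h2 : normc (\sum_(k < n) (c k - a k) * mon (coord x) (alpha k)) <= 2 * (eps / 4).
  by rewrite (le_lt_trans (normcB_le _ _))//; lra.
(* The bound for partial sums is available for polynomials only. It is applied to
   a polynomial [q] much closer to [f] than [p] is, on a set that may depend on
   [n]; the error due to [q] tends to 0 with [eta] for fixed [n] and [x]. *)
apply/ler_addgt0Pr => eta eta0.
pose C := 2 + \sum_(k < n) 8 * normc (mon (coord x) (alpha k)).
have C0 : 0 < C.
  by rewrite ltr_pwDl// sumr_ge0// => k _; rewrite mulr_ge0 ?normc_ge0.
have d0 : 0 < eta / C by rewrite divr_gt0.
have cU : compact (hull A `|` [set y | exists2 k, (k < n)%N & coef_set k y]).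
  by apply: compactU; [exact: hull_compact|exact: coef_sets_compact].
have [q /spanned_expands[b bq] qE] := spanned_dense gf cU d0.
have -> : \sum_(k < n) (c k - a k) * mon (coord x) (alpha k) =
  \sum_(k < n) (c k - b k) * mon (coord x) (alpha k) +
  \sum_(k < n) (b k - a k) * mon (coord x) (alpha k).
  by rewrite -big_split; apply: eq_bigr => k _; rewrite /= -mulrDl subrKA.
have h3 : normc (\sum_(k < n) (b k - a k) * mon (coord x) (alpha k)) <=
    2 * (eta / C + eps / 4).
  apply: (expands_partial_bound (expandsB bq ap)) => y hy.
  have hAy : hull A y by apply: hull_mono hy => _ ->.
  have -> : q y - p y = (f y - p y) - (f y - q y) by ring.
  rewrite (le_trans (normcB_le _ _))// addrC lerD// ltW//; [apply: qE|apply: pE]; by left.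
have h4 : normc (\sum_(k < n) (c k - b k) * mon (coord x) (alpha k)) <=
    eta / C * \sum_(k < n) 8 * normc (mon (coord x) (alpha k)).
  rewrite (le_trans (normc_sum _ _ _))// big_distrr /=; apply: ler_sum => k _.
  rewrite normc_mul mulrA [eta / C * 8]mulrC ler_wpM2r ?normc_ge0//.
  apply: (cP _ _ _ _ bq) => y ky; apply/ltW/qE; right; by exists k.
rewrite (le_trans (normcD_le _ _))//.
have -> : eta = eta / C * C by field; rewrite gt_eqF.
rewrite {2}/C mulrDr; move: h3 h4; rewrite -/C; lra.
Qed.

Lemma expansion_poly_coef k a p (c : R[i]) : expands a p ->
  (forall a' p' (M : R), expands a' p' ->
    (forall y, coef_set k y -> normc (p y - p' y) <= M) -> normc (c - a' k) <= 8 * M) ->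
  c = a k.
Proof.
move=> ap cP; apply/eqP; rewrite -subr_eq0 -normc_eq0 eq_le normc_ge0 andbT.
rewrite -(mulr0 8) (cP _ _ _ ap)// => y _.
by rewrite subrr Normc.normc0.
Qed.

Lemma mon_holomorphic a : (fun x => mon (coord x) a : R[i]^o) \in @holomorphic R E.
Proof.
apply/asboolP => x; rewrite /mon; elim: (enum_fset (finsupp a)) => [|j s IH].
  under eq_fun do rewrite big_nil; exact: differentiable_cst.
have dcoord : differentiable (fun x => coord x j : R[i]^o) x.
  have lin : linear (fun x => coord x j : R[i]^o).
    by move=> c u v; rewrite coordD coordZ.
  pose glM := GRing.isLinear.Build _ _ _ _ _ lin.
  pose gL : {linear E -> R[i]^o} := HB.pack (fun x => coord x j : R[i]^o) glM.
  rewrite (_ : (fun x => coord x j) = gL)//; apply: linear_differentiable.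
  exact: coord_continuous.
under eq_fun do rewrite big_cons; apply: differentiableM => //.
elim: (a j) => [|n IHn]; first by under eq_fun do rewrite expr0; exact: differentiable_cst.
by under eq_fun do rewrite exprS; exact: differentiableM.
Qed.

Definition monomial_entire k : entire E := Entire (mon_holomorphic (alpha k)).

Lemma entire_series (a : nat -> R[i]) n x :
  (series (fun k => a k *: monomial_entire k) n : entire E) x =
  \sum_(k < n) a k * mon (coord x) (alpha k).
Proof.
rewrite /series /= big_mkord; elim: n => [|n IH]; first by rewrite !big_ord0.
by rewrite !big_ord_recr /= -IH.
Qed.

(** The coefficient functionals are those of [coef_exists]. Their value on a
    polynomial is its coefficient, which with their continuity shows that no
    other coefficients represent [f]. *)
Lemma monomials_schauder_basis : schauder_basis monomial_entire.
Proof.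
have [c cP] : exists c : nat -> entire E -> R[i], forall k (f : entire E) a p (M : R),
    expands a p -> (forall y, coef_set k y -> normc (f y - p y) <= M) ->
    normc (c k f - a k) <= 8 * M.
  have c_ k := choice (fun f : entire E => coef_exists k (entire_gentire f)).
  by exists (fun k => projT1 (c_ k)) => k; exact: (projT2 (c_ k)).
have c_cont k : continuous (c k : entire E -> R[i]^o).
  move=> f U /rnorm_nbhsP[eps eps0 epsU].
  have d0 : 0 < eps / 48 by lra.
  apply/nbhs_entireP; exists (coef_set k), (eps / 48)%:C%C; split.
  - exact: coef_set_compact.
  - by rewrite ltcR.
  move=> g fg; apply: epsU; rewrite rnorm_complex.
  have [p /spanned_expands[a ap] pE] := spanned_dense (entire_gentire f) (@coef_set_compact k) d0.
  have hf : normc (c k f - a k) <= 8 * (eps / 48).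
    by apply: (cP k f _ _ _ ap) => y ky; apply/ltW/pE.
  have hg : normc (c k g - a k) <= 8 * (eps / 24).
    apply: (cP k g _ _ _ ap) => y ky.
    have := fg y ky; rewrite normE ltcR => h; have := pE y ky.
    have := normcB_le (f y - p y) (f y - g y).
    have -> : f y - p y - (f y - g y) = g y - p y by ring.
    lra.
  have -> : c k g - c k f = (c k g - a k) - (c k f - a k) by ring.
  have := normcB_le (c k g - a k) (c k f - a k); lra.
exists c; split => // f a; split=> [af k|ac].
  have c_lim : c k (series (fun k => a k *: monomial_entire k) n) @[n --> \oo] --> (c k f : R[i]^o).
    apply: (@cvg_comp _ _ _ (series (fun k => a k *: monomial_entire k))
      (c k : entire E -> R[i]^o) _ (nbhs f) _ af); exact: c_cont.
  apply/eqP; rewrite -subr_eq0 -normc_eq0 eq_le normc_ge0 andbT leNgt; apply/negP => gt0.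
  have [N HN] := (@rnorm_cvgP R R[i]^o
    (fun n => c k (series (fun k => a k *: monomial_entire k) n)) (c k f)).1 c_lim _ gt0.
  have := HN (maxn N k.+1) (leq_maxl _ _); set n := maxn N k.+1.
  have kn : (k < n)%N by rewrite leq_maxr.
  have ex : expands (fun l => if (l < n)%N then a l else 0)
      (series (fun k => a k *: monomial_entire k) n : entire E).
    exists n; first by move=> l; rewrite ltnNge => ->.
    by move=> x; rewrite entire_series; apply: eq_bigr => l _; rewrite ltn_ord.
  by rewrite (expansion_poly_coef ex (cP k _)) kn rnorm_complex ltxx.
move=> U /nbhs_entireP[A [eps [cA eps0 AU]]].
have [epsE reps0] := real_eps eps0.
have [N HN] := expansion_converges (entire_gentire f) (fun k => cP k f) cA reps0.
exists N => // n Nn; apply: AU => x Ax; rewrite epsE normE ltcR entire_series.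
rewrite (eq_bigr (fun k : 'I_n => c k f * mon (coord x) (alpha k))); first exact: HN.
by move=> k _; rewrite ac.
Qed.

End SolidSequenceSpace.

Unset Implicit Arguments.

Theorem corollary6p1 (R : realType) (E : completeNormedModType R[i])
    (coord : {linear E -> (nat -> R[i]^o)})
    (coord_inj : injective coord)
    (c00_sub : forall x : nat -> R[i], finitely_supported x ->
       exists v : E, coord v = x)
    (c00_dense : dense [set v : E | finitely_supported (coord v)])
    (solid : forall (x : E) (y : nat -> R[i]),
       (forall j, `|y j| <= `|coord x j|) ->
       exists2 v : E, coord v = y & `|v| <= `|x|)
    (e : nat -> E)
    (e_unit : forall j, coord (e j) = fun k => (k == j)%:R) :
  unconditional1_basis e /\
  forall ecoef : nat -> E -> R[i]^o, coefficient_functionals e ecoef ->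
  forall alpha : nat -> multiindex, compatible alpha ->
  exists2 m : nat -> entire E,
    (forall k (x : E), m k x = monomial ecoef (alpha k) x) &
    schauder_basis m.
Proof.
split; first exact: (unit_vectors_unconditional coord_inj c00_dense solid e_unit).
move=> ecoef ec alpha calpha.
rewrite (coefficient_functionals_coord coord_inj c00_dense solid e_unit ec).
exists (monomial_entire coord_inj solid e_unit alpha) => //.
exact: (monomials_schauder_basis coord_inj c00_dense solid e_unit calpha).
Qed.
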